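(* Let $(A,\succ,\cdot)$ be a finite-dimensional commutative tridendriform algebra, $(A_h,\succ_h,\prec_h,\cdot_h)$ a tridendriform deformation of it and $(A,[,],\triangleright,\succ,\cdot)$ the quasiclassical limit post-Poisson algebra. Put $x\circ y:=x\succ y+y\succ x+x\cdot y$, $\{x,y\}:=x\triangleright y-y\triangleright x+[x,y]$ on $A$ and $x\circ_hy:=x\succ_hy+x\prec_hy+x\cdot_hy$ on $A_h$. Consider the commutative associative algebra $(\hat A:=A\ltimes_{L_\succ}A,\odot)$, the topologically free associative algebra $(\hat A_h:=A_h\ltimes_{L_{\succ_h},R_{\prec_h}}A_h,\odot_h)$ and the Poisson algebra $(\check A:=A\ltimes_{L_\triangleright,L_\succ}A,\llbracket,\rrbracket,\odot)$, with underlying spaces $A^{\oplus2}$, $(A^{\oplus2})_h$, $A^{\oplus2}$. Fix $i\in\{1,2,3,4\}$, let $\alpha_i\in\mathrm{End}_{\mathbf k}(A^{\oplus2})$ be given by $\alpha_1(x,y)=(-x+y,0)$, $\alpha_2(x,y)=-(y,y)$, $\alpha_3(x,y)=-(x,x)$, $\alpha_4(x,y)=(0,x-y)$, and let $\alpha_{i,h}\in\mathrm{End}_{\mathbf K}((A^{\oplus2})_h)$ be given by the same formulas for $x,y\in A_h$. Let $\mathrm{id}$ and $\mathrm{id}_h$ be the identity maps of $A^{\oplus2}$ and $(A^{\oplus2})_h$. Then: (1) The topologically free associative algebra $\hat A_h\ltimes_{-R^\star_{\odot_h},-L^\star_{\odot_h}}(A^{\oplus2})_h^\star$ is an associative deformation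 of the commutative associative algebra $\hat A\ltimes_{-R^*_\odot}(A^{\oplus2})^*$, and its quasiclassical limit is exactly the Poisson algebra $\check A\ltimes_{\mathrm{ad}^*_{\llbracket,\rrbracket},-R^*_\odot}(A^{\oplus2})^*$. (2) Let $r=\eta(\tilde\alpha_i)-\sigma(\eta(\tilde\alpha_i))+\eta(\widetilde{\mathrm{id}})$ and $r_h=\eta_h(\widetilde{\alpha_{i,h}})-\sigma_{\mathbf K}(\eta_h(\widetilde{\alpha_{i,h}}))+\eta_h(\widetilde{\mathrm{id}_h})$ (respectively $r=\eta(\tilde\alpha_i)-\sigma(\eta(\tilde\alpha_i))-\sigma(\eta(\widetilde{\mathrm{id}}))$ and $r_h=\eta_h(\widetilde{\alpha_{i,h}})-\sigma_{\mathbf K}(\eta_h(\widetilde{\alpha_{i,h}}))-\sigma_{\mathbf K}(\eta_h(\widetilde{\mathrm{id}_h}))$). Starting from the commutative tridendriform algebra $(A,\succ,\cdot)$: the solution $r_h$ of the AYBE in $\hat A_h\ltimes_{-R^\star_{\odot_h},-L^\star_{\odot_h}}(A^{\oplus2})_h^\star$ determined by the tridendriform deformation $(A_h,\succ_h,\prec_h,\cdot_h)$ is the scalar deformation $\hat r$ of the solution $r$ of the AYBE in $\hat A\ltimes_{-R^*_\odot}(A^{\oplus2})^*$ determined by $(A,\succ,\cdot)$. Moreover, starting from the topologically free tridendriform algebra $(A_h,\succ_h,\prec_h,\cdot_h)$: the solution $r$ of the PYBE in $\check A\ltimes_{\mathrm{ad}^*_{\llbracket,\rrbracket},-R^*_\odot}(A^{\oplus2})^*$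 determined by the post-Poisson algebra $(A,[,],\triangleright,\succ,\cdot)$ coincides with the solution of the PYBE obtained from the solution $r_h=\hat r$ of the AYBE, whose symmetric part is invariant, by passing to the quasiclassical limit.
   Context: Throughout, $\mathbf{k}$ is a field of characteristic $0$, $\mathbf{K}=\mathbf{k}[[h]]$, $V_h=V[[h]]$; $\hat\otimes$ is the $h$-adically completed tensor product over $\mathbf K$, $V_h\hat\otimes W_h\cong(V\otimes W)[[h]]$. $L_*(x)y=x*y$, $R_*(x)y=y*x$, $\mathrm{ad}_{\llbracket,\rrbracket}(x)y=\llbracket x,y\rrbracket$. An associative deformation of $(A,\circ)$ is a $\mathbf K$-bilinear associative product $\circ_h$ on $A_h$ with $x\circ_hy\equiv x\circ y\pmod h$; for $(A,\circ)$ commutative its quasiclassical limit (QCL) is the Poisson algebra $(A,\{,\},\circ)$, $\{x,y\}\equiv\frac{x\circ_hy-y\circ_hx}{h}\pmod h$. A tridendriform algebra $(A,\succ,\prec,\cdot)$ satisfies, with $x\circ y=x\prec y+x\succ y+x\cdot y$: $(x\prec y)\prec z=x\prec(y\circ z)$, $(x\succ y)\prec z=x\succ(y\prec z)$, $(x\circ y)\succ z=x\succ(y\succ z)$, $(x\succ y)\cdot z=x\succ(y\cdot z)$, $(x\prec y)\cdot z=x\cdot(y\succ z)$, $(x\cdot y)\prec z=x\cdot(y\prec z)$, $(x\cdot y)\cdot z=x\cdot(y\cdot z)$. It is commutative, written $(A,\succ,\cdot)$, if $x\succ y=y\prec x$, $x\cdot y=y\cdot x$. A tridendriform deformation is a tridendriform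 algebra $(A_h,\succ_h,\prec_h,\cdot_h)$ with $\mathbf K$-bilinear operations on $A_h=A[[h]]$ reducing mod $h$ to $\succ,\prec,\cdot$ on $A$. Its QCL for commutative $(A,\succ,\cdot)$ is $(A,[,],\triangleright,\succ,\cdot)$ with $[x,y]\equiv\frac{x\cdot_hy-y\cdot_hx}{h}$, $x\triangleright y\equiv\frac{x\succ_hy-y\prec_hx}{h}\pmod h$. It is known to be a post-Poisson algebra; equivalently, $(A,\{,\},\circ)$ is a Poisson algebra and $(A,[,],\cdot,L_\triangleright,L_\succ)$ is an $(A,\{,\},\circ)$-module Poisson algebra. Semidirect products: for an associative algebra $(B,\circ)$ and a $B$-bimodule algebra $(V,\cdot,l,r)$ (a bimodule being the case $\cdot=0$), $B\ltimes_{l,r}V$ is $B\oplus V$ with $(x,u)\odot(y,v)=(x\circ y,l(x)v+r(y)u+u\cdot v)$; written $B\ltimes_{\rho}V$ if $B$ and $V$ are commutative and $l=r=\rho$. For a Poisson algebra $(P,\{,\},\circ)$ and a $P$-module Poisson algebra $(Q,[,],\cdot,\rho_{\{,\}},\rho_\circ)$ (a module being the case of zero operations on $Q$), $P\ltimes_{\rho_{\{,\}},\rho_\circ}Q$ is $P\oplus Q$ with bracket $(\{x,y\},\rho_{\{,\}}(x)v-\rho_{\{,\}}(y)u+[u,v])$ and product $(x\circ y,\rho_\circ(x)v+\rho_\circ(y)u+u\cdot v)$. Here $\hat A=A\ltimes_{L_\succ}A$ is formed from $(A,\circ)$ and its module algebra $(A,\cdot,L_\succ)$; $\hat A_h$ from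 $(A_h,\circ_h)$ and $(A_h,\cdot_h,L_{\succ_h},R_{\prec_h})$; $\check A$ from $(A,\{,\},\circ)$ and $(A,[,],\cdot,L_\triangleright,L_\succ)$. Duals: $\langle\varrho^*(x)u^*,v\rangle=-\langle u^*,\varrho(x)v\rangle$; $V_h^\star:=(V^* )_h\cong\mathrm{Hom}_{\mathbf K}(V_h,\mathbf K)$ with $\mathbf K$-bilinear pairing $\langle,\rangle_{\mathbf K}$, $\langle\varrho_h^\star(x)u^\star,v\rangle_{\mathbf K}=-\langle u^\star,\varrho_h(x)v\rangle_{\mathbf K}$. For a linear endomorphism $f$ of a finite-dimensional $B$, $\tilde f=\sum_if(e_i)\otimes e_i^*\in B\otimes B^*$ (basis $(e_i)$ of $B$); similarly $\tilde f\in B_h\hat\otimes B_h^\star$ for $f\in\mathrm{End}_{\mathbf K}(B_h)$. $\eta:B\otimes B^*\to(B\oplus B^* )^{\otimes2}$, $b\otimes g\mapsto(b,0)\otimes(0,g)$; $\eta_h$ is its analogue $B_h\hat\otimes B_h^\star\to(B\oplus B^* )_h\hat\otimes(B\oplus B^* )_h$ (here $B=A^{\oplus2}$); $\sigma$ is the flip and $\sigma_{\mathbf K}$ its $\mathbf K$-linear extension. The scalar deformation $\hat r$ of $r\in C\otimes C$ is its image in $C_h\hat\otimes C_h\cong(C\otimes C)[[h]]$. The symmetric part $\frac12(r_h+\sigma_{\mathbf K}(r_h))=:\beta_h$ is invariant over an associative algebra with product $\ast$ if $(\mathrm{id}\hat\otimes L_{\ast}(x)-R_{\ast}(x)\hat\otimes\mathrm{id})\beta_h=0$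 for all $x$. For $r=\sum_ia_i\otimes b_i$: AYBE (product $\circ$) is $\mathbf A(r)=\sum_{i,j}\big(a_i\circ a_j\otimes b_i\otimes b_j+a_i\otimes a_j\otimes b_i\circ b_j-a_j\otimes a_i\circ b_j\otimes b_i\big)=0$ (same over $\mathbf K$); CYBE (bracket $\{,\}$) is $\mathbf C(r)=\sum_{i,j}\big(\{a_i,a_j\}\otimes b_i\otimes b_j+a_i\otimes\{b_i,a_j\}\otimes b_j+a_i\otimes a_j\otimes\{b_i,b_j\}\big)=0$; PYBE is $\mathbf A(r)=\mathbf C(r)=0$. Known: $r$ (resp. $r_h$) as in the claim solves the AYBE in $\hat A\ltimes_{-R^*_\odot}(A^{\oplus2})^*$ (resp. in $\hat A_h\ltimes_{-R^\star_{\odot_h},-L^\star_{\odot_h}}(A^{\oplus2})_h^\star$) for any (topologically free) tridendriform algebra. *)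

(* Defs.v *)
From HB Require Import structures.
From mathcomp Require Import all_boot all_order all_algebra.
From mathcomp Require Import boolp.

Set Implicit Arguments.
Unset Strict Implicit.
Unset Printing Implicit Defensive.

Import GRing.Theory.
Local Open Scope ring_scope.

(* V[[h]], as sequences of coefficients; k[[h]] is a ring and V[[h]] a
   k[[h]]-module for V a k-module, via the Cauchy product conv. *)
Record fps (V : Type) := Fps { coeffs :> nat -> V }.

Lemma fpsP (V : Type) (f g : fps V) : (forall n, f n = g n) -> f = g.
Proof. by case: f g => f [g] /= fg; congr Fps; apply: funext. Qed.

HB.instance Definition _ (V : Type) := gen_eqMixin (fps V).
HB.instance Definition _ (V : Type) := gen_choiceMixin (fps V).

Section FpsZmodule.
Context {V : zmodType}.
Implicit Types f g : fps V.

Definition fps_zero : fps V := Fps (fun=> 0).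
Definition fps_opp f : fps V := Fps (fun n => - f n).
Definition fps_add f g : fps V := Fps (fun n => f n + g n).

Lemma fps_addA : associative fps_add.
Proof. by move=> f g e; apply: fpsP => n /=; rewrite addrA. Qed.
Lemma fps_addC : commutative fps_add.
Proof. by move=> f g; apply: fpsP => n /=; rewrite addrC. Qed.
Lemma fps_add0 : left_id fps_zero fps_add.
Proof. by move=> f; apply: fpsP => n /=; rewrite add0r. Qed.
Lemma fps_addN : left_inverse fps_zero fps_opp fps_add.
Proof. by move=> f; apply: fpsP => n /=; rewrite addNr. Qed.

HB.instance Definition _ :=
  GRing.isZmodule.Build (fps V) fps_addA fps_addC fps_add0 fps_addN.

Lemma fps0E n : (0 : fps V) n = 0. Proof. by []. Qed.
Lemma fpsDE f g n : (f + g) n = f n + g n. Proof. by []. Qed.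
Lemma fpsNE f n : (- f) n = - f n. Proof. by []. Qed.
Lemma fpsBE f g n : (f - g) n = f n - g n. Proof. by []. Qed.
Lemma fps_sumE (I : Type) (s : seq I) (P : pred I) (F : I -> fps V) n :
  (\sum_(i <- s | P i) F i) n = \sum_(i <- s | P i) F i n.
Proof. by elim/big_rec2: _ => // i x y _ <-. Qed.
End FpsZmodule.

Definition fconst {V : zmodType} (v : V) : fps V :=
  Fps (fun n => if n is 0%N then v else 0).

Definition fmap {V W : Type} (m : V -> W) (f : fps V) : fps W :=
  Fps (fun n => m (f n)).

Definition conv {U V W : zmodType} (m : U -> V -> W) (f : fps U) (g : fps V)
    : fps W :=
  Fps (fun n => \sum_(i < n.+1) m (f i) (g (n - i)%N)).

(* The class of f modulo h, and f / h for f in h V[[h]]. *)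
Definition mod_h {V : Type} (f : fps V) : V := f 0%N.
Definition div_h {V : Type} (f : fps V) : fps V := Fps (fun n => f n.+1).

Lemma sum_triangle (W : zmodType) n (F : nat -> nat -> nat -> W) :
  \sum_(i < n.+1) \sum_(j < i.+1) F j (i - j)%N (n - i)%N =
  \sum_(j < n.+1) \sum_(l < (n - j).+1) F j l (n - j - l)%N.
Proof.
transitivity (\sum_(i < n.+1) \sum_(j < n.+1 | (j <= i)%N)
                F j (i - j)%N (n - i)%N).
  apply: eq_bigr => i _.
  rewrite (big_ord_widen n.+1 (fun j => F j (i - j)%N (n - i)%N)) //.
rewrite (exchange_big_dep predT) //=; apply: eq_bigr => j _.
transitivity (\sum_(0 <= i < n.+1 | (j <= i)%N) F j (i - j)%N (n - i)%N).
  by rewrite big_mkord.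
rewrite (big_cat_nat _ (n := j)) //=; last exact: ltnW.
rewrite big_nat_cond big1 ?add0r; last first.
  by move=> i /andP[/andP[_ ij] ji]; move: ji; rewrite leqNgt ij.
rewrite -{1}(add0n j) big_addn subSn; last by rewrite -ltnS.
rewrite big_mkord; apply: eq_big => l; first by rewrite leq_addl.
by rewrite addnK [(l + j)%N]addnC subnDA.
Qed.

Lemma convA (U V W UV VW X : zmodType) (m1 : U -> VW -> X) (m2 : V -> W -> VW)
    (m3 : UV -> W -> X) (m4 : U -> V -> UV) :
  (forall u, {morph m1 u : x y / x + y}) ->
  (forall w, {morph m3^~ w : x y / x + y}) ->
  (forall u, m1 u 0 = 0) -> (forall w, m3 0 w = 0) ->
  (forall u v w, m1 u (m2 v w) = m3 (m4 u v) w) ->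
  forall f g e, conv m1 f (conv m2 g e) = conv m3 (conv m4 f g) e.
Proof.
move=> m1D m3D m10 m30 mA f g e; apply: fpsP => n /=.
under [RHS]eq_bigr => i _.
  rewrite (big_morph _ (m3D _) (m30 _)).
  under eq_bigr => j _ do rewrite -mA.
  over.
rewrite (sum_triangle n (fun a b c => m1 (f a) (m2 (g b) (e c)))).
by apply: eq_bigr => i _; rewrite (big_morph _ (m1D _) (m10 _)).
Qed.

Section FpsRing.
Context {k : comNzRingType}.

Definition fps_one : fps k := fconst 1.
Definition fps_mul : fps k -> fps k -> fps k := conv *%R.

Lemma fps_mulA : associative fps_mul.
Proof.
apply: convA => [u x y|w x y|u|w|u v w] /=.
- by rewrite mulrDr.
- by rewrite mulrDl.
- by rewrite mulr0.
- by rewrite mul0r.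
- by rewrite mulrA.
Qed.

Lemma fps_mulC : commutative fps_mul.
Proof.
move=> f g; apply: fpsP => n /=; rewrite (reindex_inj rev_ord_inj) /=.
apply: eq_bigr => i _; rewrite subSS subKn; last by rewrite -ltnS.
by rewrite mulrC.
Qed.

Lemma fps_mul1 : left_id fps_one fps_mul.
Proof.
move=> f; apply: fpsP => n /=; rewrite big_ord_recl /= mul1r subn0.
by rewrite big1 ?addr0 // => i _; rewrite mul0r.
Qed.

Lemma fps_mulD : left_distributive fps_mul +%R.
Proof.
move=> f g e; apply: fpsP => n /=; rewrite -big_split /=.
by apply: eq_bigr => i _; rewrite mulrDl.
Qed.

Lemma fps_one_neq0 : fps_one != 0.
Proof.
by apply/eqP => /(congr1 (fun f : fps k => f 0%N)) /eqP; rewrite oner_eq0.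
Qed.

HB.instance Definition _ := GRing.Zmodule_isComNzRing.Build (fps k)
  fps_mulA fps_mulC fps_mul1 fps_mulD fps_one_neq0.

Context {V : lmodType k}.

Definition fps_scale : fps k -> fps V -> fps V := conv *:%R.

Lemma fps_scaleA (a b : fps k) (f : fps V) :
  fps_scale a (fps_scale b f) = fps_scale (a * b) f.
Proof.
apply: convA => [u x y|w x y|u|w|u v w] /=.
- by rewrite scalerDr.
- by rewrite scalerDl.
- by rewrite scaler0.
- by rewrite scale0r.
- by rewrite scalerA.
Qed.

Lemma fps_scale1 : left_id 1 fps_scale.
Proof.
move=> f; apply: fpsP => n /=; rewrite big_ord_recl /= scale1r subn0.
by rewrite big1 ?addr0 // => i _; rewrite scale0r.
Qed.

Lemma fps_scaleDr : right_distributive fps_scale +%R.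
Proof.
move=> a f g; apply: fpsP => n /=; rewrite -big_split /=.
by apply: eq_bigr => i _; rewrite scalerDr.
Qed.

Lemma fps_scaleDl (f : fps V) : {morph fps_scale^~ f : a b / a + b}.
Proof.
move=> a b; apply: fpsP => n /=; rewrite -big_split /=.
by apply: eq_bigr => i _; rewrite scalerDl.
Qed.

HB.instance Definition _ := GRing.Zmodule_isLmodule.Build (fps k) (fps V)
  fps_scaleA fps_scale1 fps_scaleDr fps_scaleDl.

Lemma fpsZE (a : fps k) (f : fps V) n :
  (a *: f) n = \sum_(i < n.+1) a i *: f (n - i)%N.
Proof. by []. Qed.
End FpsRing.

Section FpsLinear.
Context {k : comNzRingType} {V W : lmodType k}.

Definition fps_hpow (q : nat) : fps k := Fps (fun m => (m == q)%:R).

Lemma fps_hpowZ (U : lmodType k) q (g : fps U) n :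
  (fps_hpow q *: g) n = if (q <= n)%N then g (n - q)%N else 0.
Proof.
rewrite fpsZE; case: leqP => qn.
  rewrite (bigD1 (Ordinal (qn : (q < n.+1)%N))) //= eqxx scale1r.
  by rewrite big1 ?addr0 // => i /negPf; rewrite -val_eqE /= => ->;
     rewrite scale0r.
rewrite big1 // => i _ /=; rewrite (_ : (i == q :> nat) = false) ?scale0r //.
by apply/negbTE/eqP => iq; move: (ltn_ord i); rewrite iq ltnS leqNgt qn.
Qed.

(* K-linear maps are automatically h-adically continuous. *)
Lemma flinear_coef (f : fps V -> fps W) v n : linear f ->
  f v n = \sum_(q < n.+1) f (fconst (v q)) (n - q)%N.
Proof.
move=> fP; pose fL := GRing.isLinear.Build (fps k) (fps V) (fps W) *:%R f fP.
pose F : {linear fps V -> fps W} := HB.pack f fL.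
have vE : v = \sum_(q < n.+1) fps_hpow q *: fconst (v q)
            + fps_hpow n.+1 *: Fps (fun m => v (m + n.+1)%N).
  apply: fpsP => m; rewrite fpsDE fps_sumE fps_hpowZ.
  under eq_bigr do rewrite fps_hpowZ.
  case: ltnP => mn.
    rewrite /= subnK // big1 ?add0r // => q _.
    case: leqP => // qm; have : (0 < m - q)%N.
      by rewrite subn_gt0 (leq_trans (ltn_ord q)).
    by case: (m - q)%N.
  rewrite (bigD1 (Ordinal (mn : (m < n.+1)%N))) //= leqnn subnn /= addr0.
  rewrite big1 ?addr0 // => q; rewrite -val_eqE /= => qm.
  case: leqP => // qm'; have : (0 < m - q)%N.
    by rewrite subn_gt0 ltn_neqAle qm.
  by case: (m - q)%N.
rewrite [in LHS]vE -[f]/(F : _ -> _) linearD linear_sum fpsDE fps_sumE linearZ.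
rewrite fps_hpowZ ltnn addr0; apply: eq_bigr => q _.
by rewrite linearZ fps_hpowZ -ltnS ltn_ord.
Qed.
End FpsLinear.

Definition fjoin {U V : Type} (p : fps U * fps V) : fps (U * V) :=
  Fps (fun n => (p.1 n, p.2 n)).
Definition fsplit {U V : Type} (f : fps (U * V)) : fps U * fps V :=
  (fmap fst f, fmap snd f).

Lemma fjoinK (U V : Type) : cancel (@fjoin U V) fsplit.
Proof. by case=> f g; congr pair; apply: fpsP. Qed.
Lemma fsplitK (U V : Type) : cancel (@fsplit U V) fjoin.
Proof. by move=> f; apply: fpsP => n /=; case: (f n). Qed.

Section Structures.
Context {R : comNzRingType} {V : lmodType R}.

Definition bilinear_op (op : V -> V -> V) : Prop :=
  (forall y, linear (op^~ y)) /\ (forall x, linear (op x)).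

Definition is_assoc_alg (op : V -> V -> V) : Prop :=
  bilinear_op op /\ associative op.

Definition is_comm_assoc_alg (op : V -> V -> V) : Prop :=
  is_assoc_alg op /\ commutative op.

Definition is_Lie_alg (br : V -> V -> V) : Prop :=
  [/\ bilinear_op br, forall x, br x x = 0 &
      forall x y z, br x (br y z) + br y (br z x) + br z (br x y) = 0].

Definition is_Poisson_alg (br op : V -> V -> V) : Prop :=
  [/\ is_Lie_alg br, is_comm_assoc_alg op &
      forall x y z, br x (op y z) = op (br x y) z + op y (br x z)].

Definition tri_circ (succ prec dot : V -> V -> V) (x y : V) : V :=
  prec x y + succ x y + dot x y.

Definition is_tridendriform (succ prec dot : V -> V -> V) : Prop :=
  let circ := tri_circ succ prec dot in
  [/\ bilinear_op succ, bilinear_op prec & bilinear_op dot] /\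
  (forall x y z,
    [/\ prec (prec x y) z = prec x (circ y z),
        prec (succ x y) z = succ x (prec y z) &
        succ (circ x y) z = succ x (succ y z)] /\
    [/\ dot (succ x y) z = succ x (dot y z),
        dot (prec x y) z = dot x (succ y z),
        prec (dot x y) z = dot x (prec y z) &
        dot (dot x y) z = dot x (dot y z)]).

Definition is_comm_tridendriform (succ dot : V -> V -> V) : Prop :=
  is_tridendriform succ (fun x y => succ y x) dot /\ commutative dot.
End Structures.

Section Deformations.
Context {k : fieldType} {V : lmodType k}.

Definition reduces_to (oph : fps V -> fps V -> fps V) (op : V -> V -> V)
    : Prop :=
  forall x y : V, mod_h (oph (fconst x) (fconst y)) = op x y.

Definition is_assoc_deformation (op : V -> V -> V)
    (oph : fps V -> fps V -> fps V) : Prop :=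
  [/\ is_assoc_alg op, is_assoc_alg oph & reduces_to oph op].

Definition is_tridend_deformation (succ prec dot : V -> V -> V)
    (succh prech doth : fps V -> fps V -> fps V) : Prop :=
  is_tridendriform succh prech doth /\
  [/\ reduces_to succh succ, reduces_to prech prec & reduces_to doth dot].

Definition qcl_bracket (oph : fps V -> fps V -> fps V) (x y : V) : V :=
  mod_h (div_h (oph (fconst x) (fconst y) - oph (fconst y) (fconst x))).

Definition qcl_triangle (succh prech : fps V -> fps V -> fps V) (x y : V) : V :=
  mod_h (div_h (succh (fconst x) (fconst y) - prech (fconst y) (fconst x))).

(* The Poisson algebra (V, br, op) is the quasiclassical limit of the
   deformation oph of the commutative algebra (V, op). *)
Definition is_QCL (oph : fps V -> fps V -> fps V) (br op : V -> V -> V)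
    : Prop :=
  [/\ is_assoc_deformation op oph, is_Poisson_alg br op &
      forall x y, br x y = qcl_bracket oph x y].
End Deformations.

Section Semidirect.
Context {B V : zmodType}.

Definition sdprod (mulB : B -> B -> B) (mulV : V -> V -> V) (l r : B -> V -> V)
    (p q : B * V) : B * V :=
  (mulB p.1 q.1, l p.1 q.2 + r q.1 p.2 + mulV p.2 q.2).

Definition comm_sdprod (mulB : B -> B -> B) (mulV : V -> V -> V)
    (rho : B -> V -> V) : B * V -> B * V -> B * V :=
  sdprod mulB mulV rho rho.

Definition sdbracket (brB : B -> B -> B) (brV : V -> V -> V)
    (rho : B -> V -> V) (p q : B * V) : B * V :=
  (brB p.1 q.1, rho p.1 q.2 - rho q.1 p.2 + brV p.2 q.2).

(* The zero operation: V as a bimodule rather than a bimodule algebra. *)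
Definition zero_op (u v : V) : V := 0.
End Semidirect.

Definition fsdprod {B V : zmodType} (mulB : fps B -> fps B -> fps B)
    (mulV : fps V -> fps V -> fps V) (l r : fps B -> fps V -> fps V)
    (p q : fps (B * V)) : fps (B * V) :=
  fjoin (sdprod mulB mulV l r (fsplit p) (fsplit q)).

Definition Lop {T : Type} (op : T -> T -> T) (x y : T) : T := op x y.
Definition Rop {T : Type} (op : T -> T -> T) (x y : T) : T := op y x.

Definition dual {k : fieldType} (V : vectType k) : vectType k := 'Hom(V, k^o).

Section Duals.
Context {k : fieldType} {V : vectType k}.

Definition dual_rep {X : Type} (rho : X -> V -> V) (x : X) (u : dual V)
    : dual V :=
  linfun (fun v => - (u (rho x v) : k^o)).

Definition fpairing (u : fps (dual V)) (v : fps V) : fps k :=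
  conv (fun (f : dual V) (w : V) => (f w : k)) u v.

(* The coefficients of the unique element of V^*[[h]] whose pairing with any
   v is - < u, rho x v >; see fpairing_dual_rep. *)
Definition fdual_rep {X : Type} (rho : X -> fps V -> fps V) (x : X)
    (u : fps (dual V)) : fps (dual V) :=
  Fps (fun n =>
    linfun (fun v => - (fpairing u (rho x (fconst v)) n : k^o))).

Lemma dual_repE (X : Type) (rho : X -> V -> V) x u v :
  linear (rho x) -> dual_rep rho x u v = - u (rho x v).
Proof.
move=> rhoP; pose f w : k^o := - (u (rho x w) : k^o).
have fP : linear f by move=> a v1 v2; rewrite /f rhoP linearP opprD scalerN.
pose fL := GRing.isLinear.Build k V k^o *:%R f fP.
pose F : {linear V -> k^o} := HB.pack f fL.
exact: (lfunE F v).
Qed.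

Lemma fpairing_dual_rep (X : Type) (rho : X -> fps V -> fps V) x u v :
  linear (rho x) ->
  fpairing (fdual_rep rho x u) v = - fpairing u (rho x v).
Proof.
move=> rhoP; pose g n w : k^o := - (fpairing u (rho x (fconst w)) n : k^o).
have rhoD w1 w2 a : rho x (fconst (a *: w1 + w2)) =
    fconst a *: rho x (fconst w1) + rho x (fconst w2).
  rewrite -rhoP; congr (rho x _); apply: fpsP => m.
  rewrite fpsDE fpsZE big_ord_recl subn0 big1 ?addr0 => [|i _].
    by case: m => //= m; rewrite scaler0 addr0.
  by rewrite scale0r.
have gP n : linear (g n).
  move=> a w1 w2; rewrite /g scalerN -opprD; congr (- _) => /=.
  rewrite scaler_sumr -big_split /=; apply: eq_bigr => i _.
  rewrite rhoD fpsDE fpsZE big_ord_recl big1 ?addr0 => [|j _].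
    by rewrite /= subn0 linearP.
  by rewrite scale0r.
have gE n w : (linfun (g n) : dual V) w = g n w.
  pose gL := GRing.isLinear.Build k V k^o *:%R (g n) (gP n).
  pose G : {linear V -> k^o} := HB.pack (g n) gL.
  exact: (lfunE G w).
apply: fpsP => n; rewrite fpsNE /=.
under eq_bigr do rewrite gE /g /=.
rewrite sumrN; congr (- _).
rewrite (sum_triangle n (fun a b c => (u a) (rho x (fconst (v c)) b) : k)).
apply: eq_bigr => i _; rewrite (flinear_coef v _ (rhoP : linear (rho x))).
rewrite linear_sum (reindex_inj rev_ord_inj) /=; apply: eq_bigr => j _.
have jn : (j <= n - i)%N by rewrite -ltnS.
by rewrite subSS subKn.
Qed.
End Duals.

Definition neg_rep {X : Type} {V : zmodType} (rho : X -> V -> V) (x : X) (v : V)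
    : V := - rho x v.

Section Bases.
Context {k : fieldType} {V : vectType k}.

Definition ebasis (i : 'I_(\dim {:V})) : V := tnth (vbasis {:V}) i.
Definition ecoord (i : 'I_(\dim {:V})) : dual V :=
  linfun (fun v : V => (coord (vbasis {:V}) i v : k^o)).

Lemma coord_ebasis (i j : 'I_(\dim {:V})) :
  coord (vbasis {:V}) i (ebasis j) = (i == j)%:R.
Proof.
rewrite /ebasis (tnth_nth 0) coord_free 1?eq_sym //.
exact: basis_free (vbasisP _).
Qed.

Lemma ebasis_coord (v : V) :
  v = \sum_i coord (vbasis {:V}) i v *: ebasis i.
Proof.
rewrite {1}(coord_vbasis (memvf v)); apply: eq_bigr => i _.
by rewrite /ebasis (tnth_nth 0).
Qed.
End Bases.

(* The elements of V (x) W are represented by their coordinates in the basis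
   (ebasis i (x) ebasis j); the universal property is tens_lift_tensor. *)
Definition tens {k : fieldType} (V W : vectType k) : vectType k :=
  'M[k]_(\dim {:V}, \dim {:W}).

Section Tensors.
Context {k : fieldType} {V W : vectType k}.

Definition tensor (v : V) (w : W) : tens V W :=
  \matrix_(i, j) (coord (vbasis {:V}) i v * coord (vbasis {:W}) j w).

(* r = \sum_i ebasis i (x) tens_row i r, see tens_decomp. *)
Definition tens_row (i : 'I_(\dim {:V})) (r : tens V W) : W :=
  \sum_j (r : 'M[k]_(_, _)) i j *: ebasis j.

(* The linear map V (x) W -> X induced by a bilinear map F. *)
Definition tens_lift {X : zmodType} (F : V -> W -> X) (r : tens V W) : X :=
  \sum_(i < \dim {:V}) F (ebasis i) (tens_row i r).

Definition ftensor (v : fps V) (w : fps W) : fps (tens V W) := conv tensor v w.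

(* The K-linear map on V_h (x^) W_h = (V (x) W)[[h]] induced by a K-bilinear
   map F, see ftens_lift_ftensor. *)
Definition ftens_lift {X : zmodType} (F : fps V -> fps W -> X)
    (r : fps (tens V W)) : X :=
  \sum_(i < \dim {:V}) F (fconst (ebasis i)) (fmap (tens_row i) r).

Lemma tens_row_tensor i v w :
  tens_row i (tensor v w) = coord (vbasis {:V}) i v *: w.
Proof.
rewrite /tens_row {2}(ebasis_coord w) scaler_sumr.
by apply: eq_bigr => j _; rewrite mxE scalerA.
Qed.

Lemma tens_decomp (r : tens V W) :
  r = \sum_i tensor (ebasis i) (tens_row i r).
Proof.
apply/matrixP => i j; rewrite summxE (bigD1 i) //= big1 => [|l li].
  rewrite mxE coord_ebasis eqxx mul1r addr0 /tens_row linear_sum /=.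
  rewrite (bigD1 j) //= linearZ /= coord_ebasis eqxx mulr1.
  by rewrite big1 ?addr0 // => l lj; rewrite linearZ /= coord_ebasis eq_sym
    (negPf lj) mulr0.
by rewrite mxE coord_ebasis eq_sym (negPf li) mul0r.
Qed.

Lemma tens_lift_tensor (X : lmodType k) (F : V -> W -> X) v w :
  (forall w, linear (F^~ w)) -> (forall v, linear (F v)) ->
  tens_lift F (tensor v w) = F v w.
Proof.
move=> Fl Fr; rewrite [in RHS](ebasis_coord v).
pose fL := GRing.isLinear.Build k V X *:%R (F^~ w) (Fl w).
pose G : {linear V -> X} := HB.pack (F^~ w) fL.
rewrite -[RHS]/(G _) linear_sum; apply: eq_bigr => i _.
rewrite linearZ tens_row_tensor.
pose fR := GRing.isLinear.Build k W X *:%R (F (ebasis i)) (Fr (ebasis i)).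
pose H : {linear W -> X} := HB.pack (F (ebasis i)) fR.
by rewrite -[LHS]/(H _) linearZ.
Qed.

Lemma ftens_lift_ftensor (X : lmodType (fps k)) (F : fps V -> fps W -> X) v w :
  (forall w, linear (F^~ w)) -> (forall v, linear (F v)) ->
  ftens_lift F (ftensor v w) = F v w.
Proof.
move=> Fl Fr.
have vE : v = \sum_i fmap (coord (vbasis {:V}) i) v *: fconst (ebasis i).
  apply: fpsP => n; rewrite fps_sumE [LHS]ebasis_coord; apply: eq_bigr => i _.
  rewrite fpsZE big_ord_recr /= subnn big1 ?add0r // => j _.
  by case: (n - j)%N (ltn_ord j) (subn_gt0 j n) => [->|p _ _] //=;
     rewrite scaler0.
rewrite [in RHS]vE.
pose fL := GRing.isLinear.Build (fps k) (fps V) X *:%R (F^~ w) (Fl w).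
pose G : {linear fps V -> X} := HB.pack (F^~ w) fL.
rewrite -[RHS]/(G _) linear_sum; apply: eq_bigr => i _.
rewrite linearZ.
have -> : fmap (tens_row i) (ftensor v w) =
    fmap (coord (vbasis {:V}) i) v *: w.
  apply: fpsP => n; rewrite fpsZE /=.
  rewrite [tens_row i _](_ : _ =
    \sum_(j < n.+1) tens_row i (tensor (v j) (w (n - j)%N))); last first.
    rewrite /tens_row exchange_big /=; apply: eq_bigr => l _.
    by rewrite summxE scaler_suml.
  by apply: eq_bigr => j _; rewrite tens_row_tensor.
pose e := fconst (ebasis i).
pose fR := GRing.isLinear.Build (fps k) (fps W) X *:%R (F e) (Fr e).
pose H : {linear fps W -> X} := HB.pack (F e) fR.
by rewrite -[LHS]/(H _) linearZ.
Qed.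
End Tensors.

Section MoreTensors.
Context {k : fieldType}.

Definition flip {V W : vectType k} : tens V W -> tens W V :=
  tens_lift (fun v w => tensor w v).
(* The K-linear extension of flip acts coefficientwise. *)
Definition fflip {V W : vectType k} : fps (tens V W) -> fps (tens W V) :=
  fmap flip.

Definition tilde {B : vectType k} (f : B -> B) : tens B (dual B) :=
  \sum_(i < \dim {:B}) tensor (f (ebasis i)) (ecoord i).
Definition ftilde {B : vectType k} (f : fps B -> fps B)
    : fps (tens B (dual B)) :=
  \sum_(i < \dim {:B}) ftensor (f (fconst (ebasis i))) (fconst (ecoord i)).

Definition dbl (B : vectType k) : vectType k := (B * dual B)%type.

Definition eta {B : vectType k} : tens B (dual B) -> tens (dbl B) (dbl B) :=
  tens_lift (fun (b : B) (g : dual B) =>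
    tensor ((b, 0) : dbl B) ((0, g) : dbl B)).
Definition feta {B : vectType k}
    : fps (tens B (dual B)) -> fps (tens (dbl B) (dbl B)) :=
  ftens_lift (fun (b : fps B) (g : fps (dual B)) =>
    ftensor (fjoin (b, 0) : fps (dbl B)) (fjoin (0, g) : fps (dbl B))).

Definition AYB {C : vectType k} (op : C -> C -> C) (r : tens C C)
    : tens (tens C C) C :=
  tens_lift (fun a b => tens_lift (fun a' b' =>
      tensor (tensor (op a a') b) b'
    + tensor (tensor a a') (op b b')
    - tensor (tensor a' (op a b')) b) r) r.

Definition fAYB {C : vectType k} (op : fps C -> fps C -> fps C)
    (r : fps (tens C C)) : fps (tens (tens C C) C) :=
  ftens_lift (fun a b => ftens_lift (fun a' b' =>
      ftensor (ftensor (op a a') b) b'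
    + ftensor (ftensor a a') (op b b')
    - ftensor (ftensor a' (op a b')) b) r) r.

Definition CYB {C : vectType k} (br : C -> C -> C) (r : tens C C)
    : tens (tens C C) C :=
  tens_lift (fun a b => tens_lift (fun a' b' =>
      tensor (tensor (br a a') b) b'
    + tensor (tensor a (br b a')) b'
    + tensor (tensor a a') (br b b')) r) r.

Definition solves_AYBE {C : vectType k} (op : C -> C -> C) (r : tens C C)
    : Prop := AYB op r = 0.
Definition solves_fAYBE {C : vectType k} (op : fps C -> fps C -> fps C)
    (r : fps (tens C C)) : Prop := fAYB op r = 0.
Definition solves_PYBE {C : vectType k} (br op : C -> C -> C) (r : tens C C)
    : Prop := AYB op r = 0 /\ CYB br r = 0.

Definition fsym_part {C : vectType k} (r : fps (tens C C)) : fps (tens C C) :=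
  fconst (2%:R^-1 : k) *: (r + fflip r).

(* (id (x) L(x) - R(x) (x) id) b = 0 for all x *)
Definition finvariant {C : vectType k} (op : fps C -> fps C -> fps C)
    (b : fps (tens C C)) : Prop :=
  forall x, ftens_lift (fun c d => ftensor c (Lop op x d)
                                   - ftensor (Rop op x c) d) b = 0.

(* r is the solution of the PYBE obtained by passing to the quasiclassical
   limit (C, br, op) of oph from the solution rh of the AYBE, whose symmetric
   part is invariant. *)
Definition is_QCL_solution {C : vectType k} (oph : fps C -> fps C -> fps C)
    (br op : C -> C -> C) (rh : fps (tens C C)) (r : tens C C) : Prop :=
  [/\ is_QCL oph br op, solves_fAYBE oph rh,
      finvariant oph (fsym_part rh), r = mod_h rh & solves_PYBE br op r].
End MoreTensors.

(* alpha_i for 1 <= i <= 4; other values of i are junk. *)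
Definition alpha {V : zmodType} (i : nat) (p : V * V) : V * V :=
  match i with
  | 1%N => (- p.1 + p.2, 0)
  | 2%N => - (p.2, p.2)
  | 3%N => - (p.1, p.1)
  | _ => (0, p.1 - p.2)
  end.

Definition falpha {V : zmodType} (i : nat) (f : fps (V * V)) : fps (V * V) :=
  fjoin (alpha i (fsplit f)).

Section RMatrices.
Context {k : fieldType} {B : vectType k}.

Definition rmatrix_id (f : B -> B) : tens (dbl B) (dbl B) :=
  eta (tilde f) - flip (eta (tilde f)) + eta (tilde id).
Definition rmatrix_flip_id (f : B -> B) : tens (dbl B) (dbl B) :=
  eta (tilde f) - flip (eta (tilde f)) - flip (eta (tilde id)).

Definition frmatrix_id (f : fps B -> fps B) : fps (tens (dbl B) (dbl B)) :=
  feta (ftilde f) - fflip (feta (ftilde f)) + feta (ftilde id).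
Definition frmatrix_flip_id (f : fps B -> fps B)
    : fps (tens (dbl B) (dbl B)) :=
  feta (ftilde f) - fflip (feta (ftilde f)) - fflip (feta (ftilde id)).
End RMatrices.

(* Main.v *)
(* Every operation D_h on C[[h]] is determined by its k-bilinear coefficients
   D_n(x, y), the coefficient of h^n in x D_h y for constant x and y. As r_h is
   the constant series r, the AYBE for r_h amounts to the AYBE for r with
   respect to each D_n, associative or not. Each D_n is built from the n-th
   coefficient m of the product of \hat A_h by adjoining the dual space, and
   alpha_i is a Rota-Baxter operator of weight 1 for m, by bilinearity alone.
   Sorting the AYBE by its components in the triple products of B and B^* turns
   it into identities for alpha_i and alpha_i + id that are equivalent to the
   Rota-Baxter identity.

   The bracket of the quasiclassical limit is the commutator of D_1, for which
   the CYBE is the difference of the AYBE for D_1 and for its opposite; the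
   Rota-Baxter identity is stable under taking opposites. The Poisson axioms
   for the quasiclassical limit are the coefficients of h and h^2 of the Leibniz
   and Jacobi identities for the commutator of D_h. *)
From HB Require Import structures.
Require Import Defs.
From mathcomp Require Import all_boot all_order all_algebra.
From mathcomp Require Import boolp ring.

Set Implicit Arguments.
Unset Strict Implicit.
Unset Printing Implicit Defensive.

Import GRing.Theory.
Local Open Scope ring_scope.

(** * Linear maps and series *)

Section PropLinear.
Context {R : comNzRingType} {V W : lmodType R} (f : V -> W).
Hypothesis fP : linear f.

Let F : {linear V -> W} := HB.pack f (GRing.isLinear.Build R V W *:%R f fP).

Lemma lin0 : f 0 = 0. Proof. exact: (linear0 F). Qed.
Lemma linN : {morph f : x / - x}. Proof. exact: (linearN F). Qed.
Lemma linD : {morph f : x y / x + y}. Proof. exact: (linearD F). Qed.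
Lemma linB : {morph f : x y / x - y}. Proof. exact: (linearB F). Qed.
Lemma linZ a : {morph f : x / a *: x}. Proof. exact: (linearZZ F). Qed.
Lemma lin_sum (I : Type) (s : seq I) (P : pred I) (E : I -> V) :
  f (\sum_(i <- s | P i) E i) = \sum_(i <- s | P i) f (E i).
Proof. exact: (linear_sum F). Qed.
End PropLinear.

(* The ring tactic does not apply to modules: identities between linear
   combinations are checked on the coordinates. *)
Lemma vect_eqP (k : fieldType) (V : vectType k) (x y : V) :
  (forall f : V -> k, {morph f : u v / u + v} -> {morph f : u / - u} ->
     f 0 = 0 -> f x = f y) -> x = y.
Proof.
move=> xy; rewrite (ebasis_coord x) (ebasis_coord y).
apply: eq_bigr => i _; congr (_ *: _).
by apply: xy; [apply: linearD | apply: linearN | apply: linear0].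
Qed.

Ltac vect_ring :=
  let f := fresh "f" in let fD := fresh "fD" in
  let fN := fresh "fN" in let f0 := fresh "f0" in
  apply: vect_eqP => f fD fN f0; rewrite ?(fD, fN, f0); ring.

(** [bilinear_op] with three modules instead of one; on a single module the two are convertible, so
    proofs of one serve for the other. *)
Definition bilin {R : comNzRingType} {U V W : lmodType R} (F : U -> V -> W) :=
  (forall v, linear (F^~ v)) /\ (forall u, linear (F u)).

Definition coef_op {U V W : zmodType} (oph : fps U -> fps V -> fps W) n x y :=
  oph (fconst x) (fconst y) n.

Lemma conv_fconstr (U V W : zmodType) (m : U -> V -> W) f v n :
  (forall u, m u 0 = 0) -> conv m f (fconst v) n = m (f n) v.
Proof.
move=> m0; rewrite /conv /= big_ord_recr /= subnn big1 ?add0r // => i _.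
by case: (n - i)%N (ltn_ord i) (subn_gt0 i n) => [->|].
Qed.

Lemma conv_fconstl (U V W : zmodType) (m : V -> U -> W) v f n :
  (forall u, m 0 u = 0) -> conv m (fconst v) f n = m v (f n).
Proof.
move=> m0; rewrite /conv /= big_ord_recl /= subn0.
by rewrite big1 ?addr0 // => i _; rewrite m0.
Qed.

Lemma convC (U V W : zmodType) (m : U -> V -> W) f g :
  conv m f g = conv (fun v u => m u v) g f.
Proof.
apply: fpsP => n; rewrite /= (reindex_inj rev_ord_inj) /=.
by apply: eq_bigr => i _; rewrite subSS subKn // -ltnS.
Qed.

Section ConstantSeries.
Context {k : comNzRingType} {V W : lmodType k}.

Lemma fconst_linear (a : k) (x y : V) :
  fconst (a *: x + y) = fconst a *: fconst x + fconst y.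
Proof.
apply: fpsP => n; rewrite fpsDE fpsZE big_ord_recl subn0 big1 ?addr0 => [|i _].
  by case: n => //= n; rewrite scaler0 addr0.
by rewrite scale0r.
Qed.

Lemma fconst0 : fconst (0 : V) = 0.
Proof. by apply: fpsP => -[]. Qed.

Lemma fconstD : {morph @fconst V : x y / x + y}.
Proof. by move=> x y; apply: fpsP => -[|n] /=; rewrite ?addr0. Qed.

Lemma fconstN : {morph @fconst V : x / - x}.
Proof. by move=> x; apply: fpsP => -[|n] /=; rewrite ?oppr0. Qed.

Lemma fconst_sum (I : Type) (s : seq I) (P : pred I) (E : I -> V) :
  fconst (\sum_(i <- s | P i) E i) = \sum_(i <- s | P i) fconst (E i).
Proof. exact: (big_morph _ fconstD fconst0). Qed.

Lemma fconstZ (a : k) (x : V) : fconst (a *: x) = fconst a *: fconst x.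
Proof. by rewrite -[a *: x]addr0 fconst_linear fconst0 addr0. Qed.

Lemma fconstZE (a : k) (f : fps V) n : (fconst a *: f) n = a *: f n.
Proof.
by rewrite fpsZE big_ord_recl subn0 big1 ?addr0 // => i _; rewrite scale0r.
Qed.

Lemma fmap_fconst (g : V -> W) (x : V) : g 0 = 0 ->
  fmap g (fconst x) = fconst (g x).
Proof. by move=> g0; apply: fpsP => -[]. Qed.

Lemma fjoin_fconst (x : V) (y : W) :
  fjoin (fconst x, fconst y) = fconst ((x, y) : V * W).
Proof. by apply: fpsP => -[]. Qed.

Lemma fsplit_fconst (p : V * W) : fsplit (fconst p) = (fconst p.1, fconst p.2).
Proof.
by rewrite -[LHS]fjoinK; case: p => x y; rewrite -fjoin_fconst !fjoinK.
Qed.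

Lemma fjoin_linear : linear (@fjoin V W : fps V * fps W -> fps (V * W)%type).
Proof.
move=> a [x y] [x' y']; apply: fpsP => n.
rewrite fpsDE fpsZE [RHS]surjective_pairing.
rewrite !raddfD !raddf_sum /=.
by [].
Qed.

Lemma fsplit_linear : linear (@fsplit V W : fps (V * W)%type -> fps V * fps W).
Proof.
move=> a p q; apply: (can_inj (@fjoinK V W)).
by rewrite fjoin_linear !fsplitK.
Qed.

Section CoefOp.
Variable oph : fps V -> fps V -> fps V.
Hypothesis ophP : bilinear_op oph.

Lemma coef_op_bilin n : bilinear_op (coef_op oph n).
Proof.
split=> [y|x] a u v; rewrite /coef_op fconst_linear.
  by rewrite ophP.1 fpsDE fconstZE.
by rewrite ophP.2 fpsDE fconstZE.
Qed.

Lemma coef_opr x g n :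
  oph (fconst x) g n = \sum_(q < n.+1) coef_op oph (n - q) x (g q).
Proof. by rewrite (flinear_coef _ _ (ophP.2 _)). Qed.

Lemma coef_opl f y n :
  oph f (fconst y) n = \sum_(q < n.+1) coef_op oph (n - q) (f q) y.
Proof. by rewrite (flinear_coef _ _ (ophP.1 (fconst y))). Qed.

(** The low degrees used below: h for the Leibniz identity, h^2 for the Jacobi identity. *)
Lemma coef_opl1 f y :
  oph f (fconst y) 1%N = coef_op oph 1 (f 0%N) y + coef_op oph 0 (f 1%N) y.
Proof. by rewrite coef_opl !big_ord_recr big_ord0 /= add0r. Qed.

Lemma coef_opr1 x g :
  oph (fconst x) g 1%N = coef_op oph 1 x (g 0%N) + coef_op oph 0 x (g 1%N).
Proof. by rewrite coef_opr !big_ord_recr big_ord0 /= add0r. Qed.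

Lemma coef_opr2 x g :
  oph (fconst x) g 2%N =
  coef_op oph 2 x (g 0%N) + coef_op oph 1 x (g 1%N) + coef_op oph 0 x (g 2%N).
Proof. by rewrite coef_opr !big_ord_recr big_ord0 /= add0r. Qed.
End CoefOp.
End ConstantSeries.

(** * Quasiclassical limits *)

Definition commutator_op {V : zmodType} (op : V -> V -> V) x y :=
  op x y - op y x.

Section QuasiclassicalLimit.
Context {k : fieldType} {V : lmodType k}.
Variable oph : fps V -> fps V -> fps V.
Hypothesis ophA : is_assoc_alg oph.

Local Notation comm := (commutator_op oph).

Lemma coef_op0_assoc_alg : is_assoc_alg (coef_op oph 0).
Proof.
have [ophP oph_assoc] := ophA; split; first exact: coef_op_bilin.
move=> x y z; have := congr1 (fun f : fps V => f 0%N)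
  (oph_assoc (fconst x) (fconst y) (fconst z)).
by rewrite (coef_opr ophP) (coef_opl ophP) !big_ord1.
Qed.

Lemma comm_bilin : bilinear_op comm.
Proof.
have [[Pl Pr] _] := ophA.
split=> [y|x] a u v; rewrite /commutator_op Pl Pr opprD addrACA scalerBr //.
Qed.

Lemma comm_Leibniz x y z :
  comm x (oph y z) = oph (comm x y) z + oph y (comm x z).
Proof.
have [[Pl Pr] assoc] := ophA; rewrite /comm.
rewrite (linB (Pl _)) (linB (Pr _)) !assoc addrA subrK //.
Qed.

Lemma commC x y : comm x y = - comm y x.
Proof. by rewrite /commutator_op opprB. Qed.

(** The commutator with x is a derivation of the product, hence also of the commutator; antisymmetry
    turns this into the cyclic form. *)
Lemma comm_Jacobi x y z :
  comm x (comm y z) + comm y (comm z x) + comm z (comm x y) = 0.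
Proof.
have [_ Cr] := comm_bilin.
have -> : comm x (comm y z) = comm (comm x y) z + comm y (comm x z).
  rewrite {1}[comm y z]/commutator_op (linB (Cr _)) !comm_Leibniz.
  by rewrite /commutator_op opprD [X in _ + X]addrC addrACA.
rewrite (commC (comm x y)) (commC x z) (linN (Cr _)).
by rewrite -addrA addrA subrK addNr.
Qed.

Hypothesis op0C : commutative (coef_op oph 0).

Let br := qcl_bracket oph.

Lemma qcl_bracketE x y : br x y = coef_op oph 1 x y - coef_op oph 1 y x.
Proof. by []. Qed.

Let coef_comm n x y :
  coef_op comm n x y = coef_op oph n x y - coef_op oph n y x.
Proof. by []. Qed.

Let coef_comm0 x y : coef_op comm 0 x y = 0.
Proof. by rewrite coef_comm op0C subrr. Qed.

(** Commutativity modulo h makes the commutator divisible by h, with leading coefficient [br]. The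
    first nontrivial degree of an identity is therefore that of h for one commutator and of h^2 for
    two nested ones. *)
Lemma qcl_Poisson_alg : is_Poisson_alg br (coef_op oph 0).
Proof.
have [ophP oph_assoc] := ophA; have commP := comm_bilin.
split; last 1 first.
- move=> x y z; have := congr1 (fun f : fps V => f 1%N)
    (comm_Leibniz (fconst x) (fconst y) (fconst z)).
  rewrite (coef_opr1 commP) fpsDE (coef_opl1 ophP (comm _ _)).
  rewrite (coef_opr1 ophP _ (comm _ _)) coef_comm0 addr0.
  rewrite ![commutator_op oph _ _ 0%N]coef_comm0.
  by rewrite (lin0 ((coef_op_bilin ophP 1).1 _))
    (lin0 ((coef_op_bilin ophP 1).2 _)) !add0r.
- split; first exact: coef_op_bilin commP 1%N.
    by move=> x; rewrite qcl_bracketE subrr.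
  move=> x y z; have := congr1 (fun f : fps V => f 2%N)
    (comm_Jacobi (fconst x) (fconst y) (fconst z)).
  rewrite 2!fpsDE !(coef_opr2 commP) !coef_comm0 !addr0.
  (* The term with [coef_op comm 2] is applied to the constant coefficient of a commutator, which is
     0; only the nested [br] remains. *)
  rewrite ![commutator_op oph _ _ 0%N]coef_comm0.
  rewrite !(lin0 ((coef_op_bilin commP _).2 _)) !add0r.
  exact.
- split=> //; exact: coef_op0_assoc_alg.
Qed.
End QuasiclassicalLimit.

(** * Semidirect products with dual spaces *)

Section SemidirectAlgebra.
Context {R : comNzRingType} {B V : lmodType R}.
Variables (mulB : B -> B -> B) (mulV : V -> V -> V) (l r : B -> V -> V).
Hypotheses (mulBP : bilin mulB) (mulVP : bilin mulV).
Hypotheses (lP : bilin l) (rP : bilin r).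

Lemma sdprod_bilin :
  bilinear_op (sdprod mulB mulV l r : (B * V)%type -> _ -> (B * V)%type).
Proof.
split=> p a [x u] [y v]; rewrite /sdprod /=; congr pair => /=.
- exact: mulBP.1.
- by rewrite lP.1 rP.2 mulVP.1 !scalerDr [RHS]addrACA [X in _ = X + _]addrACA.
- exact: mulBP.2.
- by rewrite lP.2 rP.1 mulVP.2 !scalerDr [RHS]addrACA [X in _ = X + _]addrACA.
Qed.

(** Apart from the two associativities, the hypotheses are the axioms of a bimodule algebra: three
    for the actions, three for their compatibility with [mulV]. Each matches one term of the second
    component. *)
Lemma sdprodA :
  associative mulB -> associative mulV ->
  (forall x y v, l (mulB x y) v = l x (l y v)) ->
  (forall x y v, r y (r x v) = r (mulB x y) v) ->
  (forall x y v, r y (l x v) = l x (r y v)) ->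
  (forall x u v, l x (mulV u v) = mulV (l x u) v) ->
  (forall x u v, r x (mulV u v) = mulV u (r x v)) ->
  (forall x u v, mulV (r x u) v = mulV u (l x v)) ->
  associative (sdprod mulB mulV l r).
Proof.
move=> mulBA mulVA lM rM lr lV rV rlV [x u] [y v] [z w].
rewrite /sdprod /= mulBA; congr pair.
rewrite !(linD (lP.2 _)) !(linD (rP.2 _)) !(linD (mulVP.1 _)).
rewrite !(linD (mulVP.2 _)) mulVA lM rM lr lV rV rlV -!addrA; congr (_ + _).
rewrite !addrA; congr (_ + _); rewrite -!addrA; congr (_ + _).
rewrite !addrA.
by rewrite -[RHS]addrA [RHS]addrACA [_ + mulV _ _ in RHS]addrC
  [mulV _ _ + mulV _ _ in RHS]addrC addrA.
Qed.

Lemma sdprod_assoc_alg :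
  associative mulB -> associative mulV ->
  (forall x y v, l (mulB x y) v = l x (l y v)) ->
  (forall x y v, r y (r x v) = r (mulB x y) v) ->
  (forall x y v, r y (l x v) = l x (r y v)) ->
  (forall x u v, l x (mulV u v) = mulV (l x u) v) ->
  (forall x u v, r x (mulV u v) = mulV u (r x v)) ->
  (forall x u v, mulV (r x u) v = mulV u (l x v)) ->
  is_assoc_alg (sdprod mulB mulV l r : (B * V)%type -> _ -> (B * V)%type).
Proof. by move=> *; split; [exact: sdprod_bilin | exact: sdprodA]. Qed.
End SemidirectAlgebra.

Lemma zero_op_bilin (R : comNzRingType) (V : lmodType R) :
  bilinear_op (zero_op : V -> V -> V).
Proof. by split=> ? ? ? ?; rewrite /zero_op scaler0 addr0. Qed.

Lemma fsdprod_assoc_alg (k : comNzRingType) (B V : lmodType k)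
    (mulB : fps B -> fps B -> fps B) (mulV : fps V -> fps V -> fps V)
    (l r : fps B -> fps V -> fps V) :
  is_assoc_alg (sdprod mulB mulV l r
    : (fps B * fps V)%type -> _ -> (fps B * fps V)%type) ->
  is_assoc_alg (fsdprod mulB mulV l r
    : fps (B * V)%type -> _ -> fps (B * V)%type).
Proof.
case=> [[Pl Pr] assoc]; split; last first.
  by move=> x y z; rewrite /fsdprod !fjoinK assoc.
by split=> p a x y; rewrite /fsdprod fsplit_linear ?Pl ?Pr fjoin_linear.
Qed.

(** Splitting a series of pairs acts coefficientwise, so each coefficient of the product is again a
    semidirect product, in general not an associative one. *)
Lemma coef_fsdprod (k : comNzRingType) (B V : lmodType k)
    (mulB : fps B -> fps B -> fps B) (mulV : fps V -> fps V -> fps V)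
    (l r : fps B -> fps V -> fps V) n :
  coef_op (fsdprod mulB mulV l r) n =
  sdprod (coef_op mulB n) (coef_op mulV n) (coef_op l n) (coef_op r n).
Proof.
by apply: funext => p; apply: funext => q; rewrite /coef_op /fsdprod
  !fsplit_fconst.
Qed.

Section Pairing.
Context {k : fieldType} {V : vectType k}.
Implicit Types (u : fps (dual V)) (v : fps V).

Lemma fpairing_fconstl (u : dual V) v n : fpairing (fconst u) v n = u (v n).
Proof. by rewrite /fpairing conv_fconstl // => w; rewrite zero_lfunE. Qed.

Lemma fpairing_fconstr u (v : V) n : fpairing u (fconst v) n = u n v.
Proof. by rewrite /fpairing conv_fconstr // => w; rewrite linear0. Qed.

(** Constant v already recover the coefficients of u. Identities in the dual are proved below by
    pairing both sides with v. *)
Lemma fpairing_inj u u' : (forall v, fpairing u v = fpairing u' v) -> u = u'.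
Proof.
move=> uu'; apply: fpsP => n; apply/lfunP => v.
by rewrite -!fpairing_fconstr uu'.
Qed.

Lemma fpairingZl (a : fps k) u v : fpairing (a *: u) v = a * fpairing u v.
Proof.
symmetry; apply: (@convA _ _ _ _ _ _ *%R _ _ *:%R) => [c x y|w x y|c|w|c x w].
- by rewrite mulrDr.
- by rewrite add_lfunE.
- by rewrite mulr0.
- by rewrite zero_lfunE.
- by rewrite scale_lfunE.
Qed.

Lemma fpairing_linearl v : linear (fun u => fpairing u v : (fps k)^o).
Proof.
move=> a u u'; rewrite [a *: (_ : (fps k)^o)](esym (fpairingZl a u v)).
apply: fpsP => n; rewrite fpsDE -big_split.
by apply: eq_bigr => i _; rewrite fpsDE add_lfunE.
Qed.

Lemma fpairing_linearr u : linear (fun v => fpairing u v : (fps k)^o).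
Proof.
move=> a v v'; have -> : a *: (fpairing u v : (fps k)^o) = fpairing u (a *: v).
  rewrite /fpairing (@convA _ _ _ _ _ _ _ *:%R (fun (f : dual V) w => f w : k)
    (fun (f : dual V) (c : k) => c *: f)) => [|f x y|w x y|f|w|f c w].
  - by rewrite [conv _ u a]convC; symmetry; apply: fpairingZl.
  - by rewrite linearD.
  - by rewrite add_lfunE.
  - by rewrite linear0.
  - by rewrite zero_lfunE.
  - by rewrite linearZ scale_lfunE.
apply: fpsP => n; rewrite fpsDE -big_split.
by apply: eq_bigr => i _; rewrite fpsDE linearD.
Qed.

Section DualRep.
Context {R : lmodType (fps k)} {rho : R -> fps V -> fps V}.
Hypothesis rhoP : bilin rho.

Lemma fdual_rep_bilin : bilin (fdual_rep rho).
Proof.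
split=> [u|x] a y z; apply: fpairing_inj => v; rewrite fpairing_linearl.
  rewrite !fpairing_dual_rep; try exact: rhoP.2.
  by rewrite rhoP.1 fpairing_linearr opprD scalerN.
rewrite !fpairing_dual_rep; try exact: rhoP.2.
by rewrite fpairing_linearl opprD scalerN.
Qed.
End DualRep.

Lemma neg_rep_bilin (R : comNzRingType) (U W : lmodType R) (rho : U -> W -> W) :
  bilin rho -> bilin (neg_rep rho).
Proof.
by case=> Pl Pr; split=> z a x y; rewrite /neg_rep ?Pl ?Pr opprD scalerN.
Qed.

(** The double of [m]: the dual carries the coadjoint bimodule structure. The sign of [neg_rep]
    cancels that of [fdual_rep], so x acting on u from the left pairs with v to < u, m v x >, and
    from the right to < u, m x v >. *)
Definition fsdprod_dual (m : fps V -> fps V -> fps V) :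
    fps (dbl V) -> fps (dbl V) -> fps (dbl V) :=
  fsdprod m zero_op (neg_rep (fdual_rep (Rop m))) (neg_rep (fdual_rep (Lop m))).

(** Paired with v, each bimodule axiom is u applied to an instance of the associativity of [m]; the
    axioms involving the product of the dual hold since that product is zero. *)
Lemma fsdprod_dual_assoc_alg m :
  is_assoc_alg m -> is_assoc_alg (fsdprod_dual m).
Proof.
move=> [[ml mr] mA].
have RP : bilin (Rop m) by split=> [x|x]; [apply: mr | apply: ml].
have LP : bilin (Lop m) by split.
have pairR x u v : fpairing (neg_rep (fdual_rep (Rop m)) x u) v =
    fpairing u (m v x).
  rewrite /neg_rep (linN (fpairing_linearl v)) fpairing_dual_rep ?opprK //.
  exact: RP.2.
have pairL x u v : fpairing (neg_rep (fdual_rep (Lop m)) x u) v =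
    fpairing u (m x v).
  rewrite /neg_rep (linN (fpairing_linearl v)) fpairing_dual_rep ?opprK //.
have neg0 (rho : fps V -> fps V -> fps V) : bilin rho -> 
    forall x, neg_rep (fdual_rep rho) x 0 = 0.
  by move=> P x; apply: (lin0 ((neg_rep_bilin (fdual_rep_bilin P)).2 _)).
apply: fsdprod_assoc_alg; apply: sdprod_assoc_alg => //.
- exact: zero_op_bilin.
- exact/neg_rep_bilin/fdual_rep_bilin.
- exact/neg_rep_bilin/fdual_rep_bilin.
- by move=> x y u; apply: fpairing_inj => v; rewrite !pairR mA.
- by move=> x y u; apply: fpairing_inj => v; rewrite !pairL mA.
- by move=> x y u; apply: fpairing_inj => v; rewrite !(pairL, pairR) mA.
- by move=> x u v; rewrite neg0.
- by move=> x u v; rewrite neg0.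
Qed.

(** The two dual actions are kept apart because [m] will be a coefficient of the deformed product,
    for which commutativity is known in degree 0 only. *)
Definition sdprod_dual (m : V -> V -> V) : dbl V -> dbl V -> dbl V :=
  sdprod m zero_op (neg_rep (dual_rep (Rop m))) (neg_rep (dual_rep (Lop m))).

Lemma coef_fsdprod_dual m n :
  coef_op (fsdprod_dual m) n = sdprod_dual (coef_op m n).
Proof.
rewrite coef_fsdprod /sdprod_dual; congr sdprod.
- apply: funext => x; apply: funext => u; congr (- linfun _).
  by apply: funext => v; rewrite fpairing_fconstl.
- apply: funext => x; apply: funext => u; congr (- linfun _).
  by apply: funext => v; rewrite fpairing_fconstl.
Qed.
End Pairing.

Section LinearClosure.
Context {R : comNzRingType} {U V W X : lmodType R}.

Lemma linear_id : linear (id : V -> V). Proof. by []. Qed.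

Lemma linear_comp (f : V -> W) (g : U -> V) :
  linear f -> linear g -> linear (fun x => f (g x)).
Proof. by move=> fP gP a x y; rewrite gP fP. Qed.

Lemma linear_add (f g : V -> W) :
  linear f -> linear g -> linear (fun x => f x + g x).
Proof. by move=> fP gP a x y; rewrite gP fP scalerDr addrACA. Qed.

Lemma linear_opp (f : V -> W) : linear f -> linear (fun x => - f x).
Proof. by move=> fP a x y; rewrite fP opprD scalerN. Qed.

Lemma linear_sum_fun (I : Type) (s : seq I) (f : I -> V -> W) :
  (forall i, linear (f i)) -> linear (fun x => \sum_(i <- s) f i x).
Proof.
move=> fP a x y; rewrite scaler_sumr -big_split.
by apply: eq_bigr => i _; rewrite fP.
Qed.

End LinearClosure.

Section BilinearClosure.
Context {R : comNzRingType} {U V W X : lmodType R}.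

Lemma bilin_add (F G : U -> V -> W) :
  bilin F -> bilin G -> bilin (fun u v => F u v + G u v).
Proof. by case=> ? ? [? ?]; split=> ?; apply: linear_add. Qed.

Lemma bilin_opp (F : U -> V -> W) : bilin F -> bilin (fun u v => - F u v).
Proof. by case=> ? ?; split=> ?; apply: linear_opp. Qed.

Lemma bilin_sum (I : Type) (s : seq I) (F : I -> U -> V -> W) :
  (forall i, bilin (F i)) -> bilin (fun u v => \sum_(i <- s) F i u v).
Proof.
by move=> FP; split=> ?; apply: linear_sum_fun => i;
  [apply: (FP i).1 | apply: (FP i).2].
Qed.

Lemma bilin_post (f : W -> X) (F : U -> V -> W) :
  linear f -> bilin F -> bilin (fun u v => f (F u v)).
Proof. by move=> fP [? ?]; split=> ?; apply: linear_comp. Qed.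

Lemma bilin_swap (F : V -> U -> W) : bilin F -> bilin (fun u v => F v u).
Proof. by case. Qed.
End BilinearClosure.

Lemma bilin_pre (R : comNzRingType) (U V U' V' W : lmodType R)
    (F : U -> V -> W) (f : U' -> U) (g : V' -> V) :
  bilin F -> linear f -> linear g -> bilin (fun u v => F (f u) (g v)).
Proof.
case=> Fl Fr fP gP.
by split=> ?; [apply: (linear_comp (Fl _)) | apply: (linear_comp (Fr _))].
Qed.

(** * Tensors *)

Section TensorLinearity.
Context {k : fieldType} {V W : vectType k}.

Lemma tensor_bilin : bilin (@tensor k V W).
Proof.
split=> ? a u v; apply/matrixP => i j; rewrite !mxE linearP.
  by rewrite mulrDl mulrA.
by rewrite mulrDr mulrCA.
Qed.

Lemma tens_row_linear i : linear (@tens_row k V W i).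
Proof.
move=> a r s; rewrite /tens_row scaler_sumr -big_split.
by apply: eq_bigr => j _; rewrite !mxE scalerDl scalerA.
Qed.

Lemma tens_lift_linear (X : lmodType k) (F : V -> W -> X) :
  (forall v, linear (F v)) -> linear (tens_lift F).
Proof.
move=> FP; apply: linear_sum_fun => i.
exact: linear_comp (FP _) (tens_row_linear i).
Qed.
End TensorLinearity.

Lemma flip_linear (k : fieldType) (V W : vectType k) : linear (@flip k V W).
Proof. by apply: tens_lift_linear => v; apply: tensor_bilin.1. Qed.

Lemma flip_tensor (k : fieldType) (V W : vectType k) (v : V) (w : W) :
  flip (tensor v w) = tensor w v.
Proof.
by rewrite /flip tens_lift_tensor // => ?;
  [apply: tensor_bilin.2 | apply: tensor_bilin.1].
Qed.

Section ScalarSeries.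
Context {k : fieldType} {V W : vectType k}.

Lemma ftensor_fconstl (v : V) (g : fps W) n :
  ftensor (fconst v) g n = tensor v (g n).
Proof.
by rewrite /ftensor conv_fconstl // => w; apply: (lin0 (tensor_bilin.1 w)).
Qed.

Lemma ftensor_fconstr (f : fps V) (w : W) n :
  ftensor f (fconst w) n = tensor (f n) w.
Proof.
by rewrite /ftensor conv_fconstr // => v; apply: (lin0 (tensor_bilin.2 v)).
Qed.

Lemma ftensor_fconst (v : V) (w : W) :
  ftensor (fconst v) (fconst w) = fconst (tensor v w).
Proof.
apply: fpsP => n; rewrite ftensor_fconstr; case: n => //= n.
exact: (lin0 (tensor_bilin.1 w)).
Qed.

Lemma ftens_lift_fconst (X : zmodType) (F : fps V -> fps W -> X) r :
  ftens_lift F (fconst r) =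
  tens_lift (fun v w => F (fconst v) (fconst w)) r.
Proof.
apply: eq_bigr => i _; congr F.
by rewrite fmap_fconst // (lin0 (tens_row_linear i)).
Qed.

Lemma fflip_fconst (r : tens V W) : fflip (fconst r) = fconst (flip r).
Proof. by rewrite /fflip fmap_fconst // (lin0 (@flip_linear k V W)). Qed.

End ScalarSeries.

Section ScalarRMatrix.
Context {k : fieldType} {V : vectType k}.

Lemma ftilde_fconst (g : V -> V) (gh : fps V -> fps V) :
  (forall v, gh (fconst v) = fconst (g v)) -> ftilde gh = fconst (tilde g).
Proof.
move=> ghE; rewrite /ftilde /tilde fconst_sum.
by apply: eq_bigr => i _; rewrite ghE ftensor_fconst.
Qed.

Lemma feta_fconst (t : tens V (dual V)) : feta (fconst t) = fconst (eta t).
Proof.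
rewrite /feta ftens_lift_fconst /eta /tens_lift fconst_sum.
apply: eq_bigr => i _; rewrite -(@fconst0 _ V) -(@fconst0 _ (dual V)).
by rewrite !fjoin_fconst ftensor_fconst.
Qed.
End ScalarRMatrix.

(** Every term of the equation contains the product once and is otherwise constant, so degree n
    involves [coef_op op n] alone. *)
Lemma fAYB_fconst (k : fieldType) (C : vectType k)
    (op : fps C -> fps C -> fps C) r n :
  fAYB op (fconst r) n = AYB (coef_op op n) r.
Proof.
rewrite /fAYB ftens_lift_fconst fps_sumE; apply: eq_bigr => i _.
rewrite ftens_lift_fconst fps_sumE; apply: eq_bigr => j _.
by rewrite fpsBE fpsDE !ftensor_fconst !ftensor_fconstr !ftensor_fconstl.
Qed.

(** * The CYBE for a commutator *)

Section ClassicalFromAssociative.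
Context {k : fieldType} {C : vectType k} (op : C -> C -> C).

(** After an exchange of summation indices, the last term of the AYBE reads - a (x) a'b (x) b' for
    [op] and - a (x) ba' (x) b' for its opposite; the difference is the middle term a (x) [b, a']
    (x) b' of the CYBE. The other terms match directly. *)
Lemma CYB_commutator r :
  CYB (commutator_op op) r = AYB op r - AYB (fun x y => op y x) r.
Proof.
rewrite /CYB /AYB /tens_lift.
have sumD3 (T1 T2 T3 : 'I_(\dim {:C}) -> 'I_(\dim {:C}) -> tens (tens C C) C) :
    \sum_i \sum_j (T1 i j + T2 i j + T3 i j) =
    \sum_i \sum_j T1 i j + \sum_i \sum_j T2 i j + \sum_i \sum_j T3 i j.
  by rewrite -!big_split; apply: eq_bigr => i _; rewrite -!big_split.
rewrite !sumD3.
have swap (opx : C -> C -> C) :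
  \sum_(i < \dim {:C}) \sum_(j < \dim {:C})
    - tensor (tensor (ebasis j) (opx (ebasis i) (tens_row j r)))
        (tens_row i r) =
  - \sum_(i < \dim {:C}) \sum_(j < \dim {:C})
    tensor (tensor (ebasis i) (opx (ebasis j) (tens_row i r))) (tens_row j r).
  rewrite exchange_big -sumrN; apply: eq_bigr => i _.
  by rewrite -sumrN.
rewrite (swap op) (swap (fun x y => op y x)).
have sumB2 (T1 T2 : 'I_(\dim {:C}) -> 'I_(\dim {:C}) -> tens (tens C C) C) :
    \sum_i \sum_j (T1 i j - T2 i j) =
    \sum_i \sum_j T1 i j - \sum_i \sum_j T2 i j.
  by rewrite -sumrB; apply: eq_bigr => i _; rewrite -sumrB.
rewrite /commutator_op.
under eq_bigr do under eq_bigr do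
  rewrite (linB (tensor_bilin.1 _)) (linB (tensor_bilin.1 _)).
rewrite sumB2.
under [X in _ + X + _]eq_bigr do under eq_bigr do
  rewrite (linB (tensor_bilin.2 _)) (linB (tensor_bilin.1 _)).
rewrite sumB2.
under [X in _ + X = _]eq_bigr do under eq_bigr do
  rewrite (linB (tensor_bilin.2 _)).
rewrite sumB2.
vect_ring.
Qed.
End ClassicalFromAssociative.

(** * The Yang-Baxter equations *)

Section Transpose.
Context {k : fieldType} {B : vectType k}.

Lemma ecoordE i (v : B) : ecoord i v = coord (vbasis {:B}) i v.
Proof. exact: (lfunE (coord (vbasis {:B}) i : {linear B -> k^o}) v). Qed.

Lemma dual_decomp (u : dual B) : u = \sum_i u (ebasis i) *: ecoord i.
Proof.
apply/lfunP => v; rewrite sum_lfunE {1}(ebasis_coord v) linear_sum.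
apply: eq_bigr => i _; rewrite linearZ scale_lfunE ecoordE.
by rewrite [RHS]mulrC.
Qed.

(* The canonical element of B (x) B^* satisfies
   (id (x) phi^T)(id~) = (phi (x) id)(id~). *)
Lemma transpose_sum (X : lmodType k) (T : B -> dual B -> X) (phi : B -> B)
    (u : 'I_(\dim {:B}) -> dual B) :
  bilin T -> (forall i v, u i v = ecoord i (phi v)) ->
  \sum_i T (ebasis i) (u i) = \sum_i T (phi (ebasis i)) (ecoord i).
Proof.
move=> [Tl Tr] uE.
transitivity (\sum_i \sum_j
    coord (vbasis {:B}) i (phi (ebasis j)) *: T (ebasis i) (ecoord j)).
  apply: eq_bigr => i _; rewrite [u i]dual_decomp (lin_sum (Tr _)).
  by apply: eq_bigr => j _; rewrite uE ecoordE (linZ (Tr _)).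
rewrite exchange_big; apply: eq_bigr => j _.
rewrite [phi _ in RHS]ebasis_coord (lin_sum (Tl _)).
by apply: eq_bigr => i _; rewrite (linZ (Tl _)).
Qed.
End Transpose.

(* Stated for variables, as the ring tactic would compare actual tensors up to
   conversion, which does not terminate in reasonable time. *)
Lemma regroup_AYB_terms (k : fieldType) (V : vectType k)
    (a1 a2 a3 b1 b2 b3 c1 c2 c3 : V) :
  a1 + 0 - a3 - (c2 + a2 - b1) - (b2 + b3 - 0 - (0 + c1 - c3)) =
  a1 - a2 - a3 + (b1 - b2 - b3) + (c1 - c2 - c3).
Proof. vect_ring. Qed.

Section DualDouble.
Context {k : fieldType} {B : vectType k} (m : B -> B -> B).
Hypothesis mP : bilinear_op m.

Local Notation lact := (neg_rep (dual_rep (Rop m))).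
Local Notation ract := (neg_rep (dual_rep (Lop m))).

Lemma lactE b u v : lact b u v = u (m v b).
Proof. by rewrite /neg_rep opp_lfunE dual_repE ?opprK //; apply: mP.1. Qed.

Lemma ractE b u v : ract b u v = u (m b v).
Proof. by rewrite /neg_rep opp_lfunE dual_repE ?opprK //; apply: mP.2. Qed.

Lemma lact_bilin : bilin lact.
Proof.
split=> [u|b] a x y; apply/lfunP => v; rewrite add_lfunE scale_lfunE !lactE.
  by rewrite mP.2 linearP.
by rewrite add_lfunE scale_lfunE.
Qed.

Lemma ract_bilin : bilin ract.
Proof.
split=> [u|b] a x y; apply/lfunP => v; rewrite add_lfunE scale_lfunE !ractE.
  by rewrite mP.1 linearP.
by rewrite add_lfunE scale_lfunE.
Qed.

Lemma sdprod_dual_bilin : bilinear_op (sdprod_dual m).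
Proof.
exact: (sdprod_bilin mP (zero_op_bilin _) lact_bilin ract_bilin).
Qed.

Definition dinl (b : B) : dbl B := (b, 0).
Definition dinr (u : dual B) : dbl B := (0, u).

Lemma dinl_linear : linear dinl.
Proof. by move=> a x y; congr pair; rewrite /= scaler0 addr0. Qed.

Lemma dinr_linear : linear dinr.
Proof. by move=> a x y; congr pair; rewrite /= scaler0 addr0. Qed.

Lemma sdprod_dual_ll b c : sdprod_dual m (dinl b) (dinl c) = dinl (m b c).
Proof.
congr pair; rewrite /= (lin0 (lact_bilin.2 _)) (lin0 (ract_bilin.2 _)).
by rewrite !addr0.
Qed.

Lemma sdprod_dual_lr b u : sdprod_dual m (dinl b) (dinr u) = dinr (lact b u).
Proof.
congr pair; rewrite /= ?(lin0 (mP.2 _)) // (lin0 (ract_bilin.2 _)).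
by rewrite !addr0.
Qed.

Lemma sdprod_dual_rl u b : sdprod_dual m (dinr u) (dinl b) = dinr (ract b u).
Proof.
congr pair; rewrite /= ?(lin0 (mP.1 _)) // (lin0 (lact_bilin.2 _)).
by rewrite add0r addr0.
Qed.

Lemma sdprod_dual_rr u v : sdprod_dual m (dinr u) (dinr v) = 0.
Proof.
congr pair; rewrite /= ?(lin0 (mP.1 _)) //.
by rewrite (lin0 (lact_bilin.1 _)) (lin0 (ract_bilin.1 _)) !addr0.
Qed.

Lemma sdprod_dual_opp p q :
  sdprod_dual m q p = sdprod_dual (fun x y => m y x) p q.
Proof.
by congr pair; rewrite /= !addr0 addrC.
Qed.

Definition canonical_tensor (f : B -> B) : tens (dbl B) (dbl B) :=
  \sum_i tensor (dinl (f (ebasis i))) (dinr (ecoord i)).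

Lemma eta_tilde (f : B -> B) : eta (tilde f) = canonical_tensor f.
Proof.
have P : bilin (fun b (g : dual B) => tensor (dinl b) (dinr g)).
  exact: bilin_pre tensor_bilin dinl_linear dinr_linear.
rewrite /eta (lin_sum (tens_lift_linear P.2)).
by apply: eq_bigr => i _; apply: (tens_lift_tensor _ _ P.1 P.2).
Qed.

(** Covers both choices of r: f = alpha + id, g = alpha for the first, f = alpha, g = alpha + id for
    the second. *)
Definition skew_rmatrix (f g : B -> B) : tens (dbl B) (dbl B) :=
  canonical_tensor f - flip (canonical_tensor g).

Lemma tens_lift_skew_rmatrix (X : lmodType k) (F : dbl B -> dbl B -> X) f g :
  bilin F -> tens_lift F (skew_rmatrix f g) =
  \sum_i (F (dinl (f (ebasis i))) (dinr (ecoord i))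
          - F (dinr (ecoord i)) (dinl (g (ebasis i)))).
Proof.
move=> FP; rewrite /skew_rmatrix /canonical_tensor.
rewrite (lin_sum (@flip_linear _ _ _)).
rewrite -sumrB (lin_sum (tens_lift_linear FP.2)); apply: eq_bigr => i _.
rewrite (linB (tens_lift_linear FP.2)) flip_tensor.
by rewrite !(tens_lift_tensor _ _ FP.1 FP.2).
Qed.

Variables f g : B -> B.
Hypotheses (fP : linear f) (gP : linear g).
(** One identity for each of the components [T1], [T2], [T3] of the AYBE below; each amounts to the
    Rota-Baxter identity for a when f and g are a and a + id in either order. *)
Hypothesis ff : forall x y, m (f x) (f y) = f (m (g x) y + m x (f y)).
Hypothesis fg : forall x y, m (f y) (g x) = g (m (f y) x) + f (m y (g x)).
Hypothesis gg : forall x y, m (g x) (g y) = g (m x (f y) + m (g x) y).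

Local Notation D := (sdprod_dual m).
Local Notation t3 a b c := (tensor (tensor a b) c).
Local Notation e := (@ebasis k B).
Local Notation e' := (@ecoord k B).

Let D1 := sdprod_dual_bilin.1.
Let D2 := sdprod_dual_bilin.2.

(** The dual is an ideal of square zero, so each surviving term has one factor in B and two in the
    dual. [transpose_sum] moves the actions on basis functionals to the factor in B, where the
    hypotheses apply. *)
Lemma AYB_skew_rmatrix : AYB D (skew_rmatrix f g) = 0.
Proof.
pose G a b a' b' : tens (tens (dbl B) (dbl B)) (dbl B) :=
  t3 (D a a') b b' + t3 a a' (D b b') - t3 a' (D a b') b.
have Gr a b : bilin (G a b).
  apply: bilin_add; first apply: bilin_add; last apply: bilin_opp.
  - exact: (bilin_pre tensor_bilin (linear_comp (tensor_bilin.1 _) (D2 a))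
      linear_id).
  - exact: (bilin_pre tensor_bilin (tensor_bilin.2 a) (D2 b)).
  - apply: (bilin_post (tensor_bilin.1 b)).
    exact: (bilin_pre tensor_bilin linear_id (D2 a)).
have Gl a' b' : bilin (fun a b => G a b a' b').
  apply: bilin_add; first apply: bilin_add; last apply: bilin_opp.
  - apply: (bilin_post (tensor_bilin.1 b')).
    exact: (bilin_pre tensor_bilin (D1 a') linear_id).
  - exact: (bilin_pre tensor_bilin (tensor_bilin.1 a') (D1 b')).
  - exact: (bilin_pre tensor_bilin (linear_comp (tensor_bilin.2 a') (D1 b'))
      linear_id).
have -> : AYB D (skew_rmatrix f g) = tens_lift (fun a b => \sum_j
    (G a b (dinl (f (e j))) (dinr (e' j))
     - G a b (dinr (e' j)) (dinl (g (e j)))))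
    (skew_rmatrix f g).
  congr tens_lift; apply: funext => a; apply: funext => b.
  exact: tens_lift_skew_rmatrix (Gr a b).
rewrite tens_lift_skew_rmatrix; last first.
  apply: bilin_sum => j; apply: bilin_add; first exact: Gl.
  exact/bilin_opp/Gl.
pose S (T : 'I_(\dim {:B}) -> 'I_(\dim {:B}) ->
  tens (tens (dbl B) (dbl B)) (dbl B)) := \sum_i \sum_j T i j.
have SD T T' : S (fun i j => T i j + T' i j) = S T + S T'.
  by rewrite /S -big_split; apply: eq_bigr => i _; rewrite -big_split.
have Sswap T : S T = S (fun i j => T j i) by rewrite /S exchange_big.
(* The cancellation pattern of all three components: X splits into two terms pointwise, while Y and
   Z agree with these only after summation. *)
have S0 X Y Z Y' Z' : S Y = S Y' -> S Z = S Z' ->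
    (forall i j, X i j = Y' i j + Z' i j) ->
    S (fun i j => X i j - Y i j - Z i j) = 0.
  move=> YY' ZZ' XE; have SN T : S (fun i j => - T i j) = - S T.
    by rewrite /S -sumrN; apply: eq_bigr => i _; rewrite -sumrN.
  rewrite (SD (fun i j => X i j - Y i j)) (SD X) !SN YY' ZZ' -addrA -opprD -SD.
  apply/eqP; rewrite subr_eq0; apply/eqP.
  by apply: eq_bigr => i _; apply: eq_bigr => j _.
(* T1, T2 and T3 are the components in B (x) B^* (x) B^*, B^* (x) B (x) B^* and
   B^* (x) B^* (x) B. *)
pose T1 i j :=
  t3 (D (dinl (f (e i))) (dinl (f (e j)))) (dinr (e' i)) (dinr (e' j))
  - t3 (dinl (f (e i))) (dinr (e' j)) (D (dinr (e' i)) (dinl (g (e j))))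
  - t3 (dinl (f (e j))) (D (dinl (f (e i))) (dinr (e' j))) (dinr (e' i)).
pose T2 i j :=
  t3 (dinr (e' j)) (D (dinl (f (e i))) (dinl (g (e j)))) (dinr (e' i))
  - t3 (D (dinr (e' i)) (dinl (f (e j)))) (dinl (g (e i))) (dinr (e' j))
  - t3 (dinr (e' i)) (dinl (f (e j))) (D (dinl (g (e i))) (dinr (e' j))).
pose T3 i j :=
  t3 (dinr (e' i)) (dinr (e' j)) (D (dinl (g (e i))) (dinl (g (e j))))
  - t3 (D (dinl (f (e i))) (dinr (e' j))) (dinr (e' i)) (dinl (g (e j)))
  - t3 (dinr (e' j)) (D (dinr (e' i)) (dinl (g (e j)))) (dinl (g (e i))).
transitivity (S (fun i j => T1 i j + T2 i j + T3 i j)).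
  apply: eq_bigr => i _; rewrite -sumrB; apply: eq_bigr => j _.
  rewrite /G /T1 /T2 /T3 !sdprod_dual_rr.
  rewrite !(lin0 (tensor_bilin.1 _)) !(lin0 (tensor_bilin.2 _)).
  rewrite !(lin0 (tensor_bilin.1 _)).
  apply: regroup_AYB_terms.
rewrite (SD (fun i j => T1 i j + T2 i j)) (SD T1).
have -> : S T1 = 0.
  apply: (S0 _ _ _
    (fun i j => t3 (dinl (f (m (g (e i)) (e j)))) (dinr (e' i)) (dinr (e' j)))
    (fun i j => t3 (dinl (f (m (e i) (f (e j))))) (dinr (e' i)) (dinr (e' j)))).
  - rewrite Sswap; apply: eq_bigr => j _.
    under eq_bigr do rewrite sdprod_dual_rl.
    (* The right action is the transpose of left multiplication by g (e j), the left action below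
       that of right multiplication by f (e i); both land in the argument of f. *)
    apply: (transpose_sum
      (T := fun b u => t3 (dinl (f b)) (dinr (e' j)) (dinr u))
      (phi := m (g (e j)))) => [|i v]; last exact: ractE.
    exact: bilin_pre tensor_bilin (linear_comp (tensor_bilin.1 _)
      (linear_comp dinl_linear fP)) dinr_linear.
  - rewrite [RHS]Sswap; apply: eq_bigr => i _.
    under eq_bigr do rewrite sdprod_dual_lr.
    apply: (transpose_sum
      (T := fun b u => t3 (dinl (f b)) (dinr u) (dinr (e' i)))
      (phi := fun b => m b (f (e i)))) => [|j v]; last exact: lactE.
    apply: (bilin_post (tensor_bilin.1 _)).
    exact: bilin_pre tensor_bilin (linear_comp dinl_linear fP) dinr_linear.
  - move=> i j; rewrite sdprod_dual_ll ff (linD fP) (linD dinl_linear).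
    by rewrite !(linD (tensor_bilin.1 _)).
have -> : S T2 = 0.
  apply: (S0 _ _ _
    (fun i j => t3 (dinr (e' j)) (dinl (g (m (f (e i)) (e j)))) (dinr (e' i)))
    (fun i j => t3 (dinr (e' j)) (dinl (f (m (e i) (g (e j))))) (dinr (e' i)))).
  - rewrite Sswap; apply: eq_bigr => j _.
    under eq_bigr do rewrite sdprod_dual_rl.
    apply: (transpose_sum
      (T := fun b u => t3 (dinr u) (dinl (g b)) (dinr (e' j)))
      (phi := m (f (e j)))) => [|i v]; last exact: ractE.
    apply: (bilin_post (tensor_bilin.1 _)); apply: bilin_swap.
    exact: bilin_pre tensor_bilin dinr_linear (linear_comp dinl_linear gP).
  - rewrite [RHS]Sswap; apply: eq_bigr => i _.
    under eq_bigr do rewrite sdprod_dual_lr.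
    apply: (transpose_sum
      (T := fun b u => t3 (dinr (e' i)) (dinl (f b)) (dinr u))
      (phi := fun b => m b (g (e i)))) => [|j v]; last exact: lactE.
    exact: bilin_pre tensor_bilin (linear_comp (tensor_bilin.2 _)
      (linear_comp dinl_linear fP)) dinr_linear.
  - move=> i j; rewrite sdprod_dual_ll fg (linD dinl_linear).
    by rewrite (linD (tensor_bilin.2 _)) (linD (tensor_bilin.1 _)).
have -> : S T3 = 0.
  apply: (S0 _ _ _
    (fun i j => t3 (dinr (e' i)) (dinr (e' j)) (dinl (g (m (e i) (f (e j))))))
    (fun i j => t3 (dinr (e' i)) (dinr (e' j)) (dinl (g (m (g (e i)) (e j)))))).
  - rewrite [RHS]Sswap; apply: eq_bigr => i _.
    under eq_bigr do rewrite sdprod_dual_lr.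
    apply: (transpose_sum
      (T := fun b u => t3 (dinr u) (dinr (e' i)) (dinl (g b)))
      (phi := fun b => m b (f (e i)))) => [|j v]; last exact: lactE.
    apply: bilin_swap; exact: bilin_pre tensor_bilin
      (linear_comp (tensor_bilin.1 _) dinr_linear) (linear_comp dinl_linear gP).
  - rewrite Sswap; apply: eq_bigr => j _.
    under eq_bigr do rewrite sdprod_dual_rl.
    apply: (transpose_sum
      (T := fun b u => t3 (dinr (e' j)) (dinr u) (dinl (g b)))
      (phi := m (g (e j)))) => [|i v]; last exact: ractE.
    apply: bilin_swap; exact: bilin_pre tensor_bilin
      (linear_comp (tensor_bilin.2 _) dinr_linear) (linear_comp dinl_linear gP).
  - move=> i j; rewrite sdprod_dual_ll gg (linD gP) (linD dinl_linear).
    by rewrite (linD (tensor_bilin.2 _)).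
by rewrite !addr0.
Qed.
End DualDouble.

(** * Rota-Baxter operators of weight 1 *)

Definition rota_baxter (V : zmodType) (m : V -> V -> V) (a : V -> V) :=
  forall x y, m (a x) (a y) = a (m (a x) y + m x (a y) + m x y).

Lemma rota_baxter_opp (V : zmodType) (m : V -> V -> V) a :
  rota_baxter m a -> rota_baxter (fun x y => m y x) a.
Proof. by move=> aRB x y; rewrite aRB [X in a (X + _)]addrC. Qed.

Section RotaBaxterSolution.
Context {k : fieldType} {B : vectType k} (m : B -> B -> B) (a : B -> B).
Hypotheses (mP : bilinear_op m) (aP : linear a) (aRB : rota_baxter m a).

Let a1 x := a x + x.

Let a1P : linear a1.
Proof. exact: linear_add aP linear_id. Qed.

Lemma AYB_rota_baxterl : AYB (sdprod_dual m) (skew_rmatrix a1 a) = 0.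
Proof.
have mDl z := linD (mP.1 z); have mDr z := linD (mP.2 z); have aD := linD aP.
apply: AYB_skew_rmatrix => // x y; rewrite /a1 !(mDl, mDr) aRB !aD; vect_ring.
Qed.

Lemma AYB_rota_baxterr : AYB (sdprod_dual m) (skew_rmatrix a a1) = 0.
Proof.
have mDl z := linD (mP.1 z); have mDr z := linD (mP.2 z); have aD := linD aP.
apply: AYB_skew_rmatrix => // x y; rewrite /a1 !(mDl, mDr) aRB !aD; vect_ring.
Qed.
End RotaBaxterSolution.

(** * Invariance of the symmetric part *)

Lemma tens_lift_flip (k : fieldType) (V W : vectType k) (X : lmodType k)
    (F : W -> V -> X) (t : tens V W) :
  bilin F -> tens_lift F (flip t) = tens_lift (fun v w => F w v) t.
Proof.
move=> FP; have -> : flip t = \sum_i tensor (tens_row i t) (ebasis i) by [].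
rewrite (lin_sum (tens_lift_linear FP.2)).
by apply: eq_bigr => i _; apply: (tens_lift_tensor _ _ FP.1 FP.2).
Qed.

Lemma flipK (k : fieldType) (V W : vectType k) (t : tens V W) :
  flip (flip t) = t.
Proof.
rewrite [flip (flip t)]tens_lift_flip; last exact/bilin_swap/tensor_bilin.
by rewrite [RHS]tens_decomp.
Qed.

Section Casimir.
Context {k : fieldType} {B : vectType k}.

(** The canonical symmetric element of the double, dual to the natural pairing of B with its dual;
    the symmetric part of either r is a multiple of it. *)
Definition casimir : tens (dbl B) (dbl B) :=
  canonical_tensor id + flip (canonical_tensor id).

Lemma canonical_tensorD (f g : B -> B) :
  canonical_tensor (fun x => f x + g x) =
  canonical_tensor f + canonical_tensor g.
Proof.
rewrite -big_split; apply: eq_bigr => i _.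
by rewrite (linD dinl_linear) (linD (tensor_bilin.1 _)).
Qed.

(** Symmetrisation leaves f - g, which for the two choices of r is id or - id. *)
Lemma skew_rmatrix_sym_part (f g : B -> B) (c : k) :
  (forall x, f x - g x = c *: x) ->
  skew_rmatrix f g + flip (skew_rmatrix f g) = c *: casimir.
Proof.
move=> fg; have E :
    canonical_tensor f - canonical_tensor g = c *: canonical_tensor id.
  rewrite /canonical_tensor scaler_sumr -sumrB; apply: eq_bigr => i _.
  by rewrite -(linB (tensor_bilin.1 _)) -(linB dinl_linear) fg
    (linZ dinl_linear) (linZ (tensor_bilin.1 _)).
rewrite /casimir scalerDr -(linZ (@flip_linear _ _ _)) -E.
rewrite /skew_rmatrix !(linB (@flip_linear _ _ _)) flipK [X in _ + X]addrC.
by rewrite [LHS]addrACA [X in _ + X]addrC.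
Qed.

Variable m : B -> B -> B.
Hypothesis mP : bilinear_op m.
Local Notation D := (sdprod_dual m).

(** Dual form of the invariance < cx, d > = < c, xd > of the natural pairing on the double. In
    coordinates, the mixed components agree by [transpose_sum]. *)
Lemma casimir_invariant x :
  tens_lift (fun c d => tensor c (D x d) - tensor (D c x) d) casimir = 0.
Proof.
have Dbil := sdprod_dual_bilin mP.
pose F c d := tensor c (D x d) - tensor (D c x) d.
have FP : bilin F.
  apply: bilin_add; last apply: bilin_opp.
  - exact: bilin_pre tensor_bilin linear_id (Dbil.2 x).
  - exact: bilin_pre tensor_bilin (Dbil.1 x) linear_id.
rewrite [LHS](linD (tens_lift_linear FP.2)) tens_lift_flip //.
have tensE (G : dbl B -> dbl B -> _) : bilin G -> 
    tens_lift G (canonical_tensor id) =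
    \sum_i G (dinl (ebasis i)) (dinr (ecoord i)).
  move=> GP; rewrite (lin_sum (tens_lift_linear GP.2)).
  by apply: eq_bigr => i _; apply: (tens_lift_tensor _ _ GP.1 GP.2).
rewrite !tensE //; last exact: bilin_swap.
have D_lr u : D x (dinr u) = dinr (neg_rep (dual_rep (Rop m)) x.1 u).
  congr pair; rewrite /= ?(lin0 (mP.2 _)) //.
  by rewrite (lin0 ((ract_bilin mP).1 _)) ?addr0.
have D_rl u : D (dinr u) x = dinr (neg_rep (dual_rep (Lop m)) x.1 u).
  congr pair; rewrite /= ?(lin0 (mP.1 _)) //.
  by rewrite (lin0 ((lact_bilin mP).1 _)) ?add0r ?addr0.
have D_l b : D (dinl b) x =
    dinl (m b x.1) + dinr (neg_rep (dual_rep (Rop m)) b x.2).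
  congr pair; rewrite /= ?addr0 //.
  by rewrite (lin0 ((ract_bilin mP).2 _)) ?add0r ?addr0.
have D_r b : D x (dinl b) =
    dinl (m x.1 b) + dinr (neg_rep (dual_rep (Lop m)) b x.2).
  congr pair; rewrite /= ?addr0 //.
  by rewrite (lin0 ((lact_bilin mP).2 _)) ?add0r ?addr0.
have inlrP : bilin (fun (b : B) (u : dual B) => tensor (dinl b) (dinr u)).
  exact: bilin_pre tensor_bilin dinl_linear dinr_linear.
have inrlP : bilin (fun (b : B) (u : dual B) => tensor (dinr u) (dinl b)).
  exact: bilin_swap (bilin_pre tensor_bilin dinr_linear dinl_linear).
rewrite !sumrB.
under eq_bigr do rewrite D_lr.
rewrite (transpose_sum (phi := fun b => m b x.1) inlrP) => [|i v]; last first.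
  exact: lactE.
under [X in _ + (_ - X)]eq_bigr do rewrite D_rl.
rewrite (transpose_sum (phi := m x.1) inrlP) => [|i v]; last exact: ractE.
under [X in _ - X + _]eq_bigr do rewrite D_l (linD (tensor_bilin.1 _)).
under [X in _ + (X - _)]eq_bigr do rewrite D_r (linD (tensor_bilin.2 _)).
rewrite !big_split /=.
(* In the component with both factors in the dual, the coefficients on either side are the values of
   x.2 on products of two basis vectors. *)
have -> : \sum_i tensor (dinr (neg_rep (dual_rep (Rop m)) (ebasis i) x.2))
      (dinr (ecoord i)) =
    \sum_i tensor (dinr (ecoord i))
      (dinr (neg_rep (dual_rep (Lop m)) (ebasis i) x.2)).
  transitivity (\sum_i \sum_j x.2 (m (ebasis j) (ebasis i)) *:
      tensor (dinr (ecoord j)) (dinr (ecoord i))).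
    apply: eq_bigr => i _; rewrite [neg_rep _ _ _]dual_decomp.
    rewrite (lin_sum dinr_linear) (lin_sum (tensor_bilin.1 _)).
    apply: eq_bigr => j _.
    by rewrite (linZ dinr_linear) (linZ (tensor_bilin.1 _)) lactE.
  rewrite exchange_big; apply: eq_bigr => i _ /=.
  rewrite [neg_rep _ _ _]dual_decomp.
  rewrite (lin_sum dinr_linear) (lin_sum (tensor_bilin.2 _)).
  apply: eq_bigr => j _.
  by rewrite (linZ dinr_linear) (linZ (tensor_bilin.2 _)) ractE.
rewrite [X in _ + X]addrAC subrr add0r opprD [X in X + _]addrA subrr add0r.
exact: addNr.
Qed.
End Casimir.

(** The test element x is itself a series; degree n collects the conditions for [coef_op op (n - q)]
    and the coefficient x q. *)
Lemma finvariant_fconst (k : fieldType) (C : vectType k)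
    (op : fps C -> fps C -> fps C) (t : tens C C) :
  bilinear_op op ->
  (forall n x, tens_lift (fun c d => tensor c (coef_op op n x d)
                                   - tensor (coef_op op n c x) d) t = 0) ->
  finvariant op (fconst t).
Proof.
move=> opP tP x; rewrite ftens_lift_fconst; apply: fpsP => n.
rewrite fps_sumE fps0E.
transitivity (\sum_(q < n.+1) tens_lift (fun c d =>
    tensor c (coef_op op (n - q) (x q) d)
    - tensor (coef_op op (n - q) c (x q)) d) t); last by rewrite big1.
rewrite exchange_big; apply: eq_bigr => i _.
rewrite fpsBE ftensor_fconstl ftensor_fconstr /Lop /Rop sumrB.
by rewrite (coef_opl opP) (coef_opr opP) (lin_sum (tensor_bilin.2 _))
  (lin_sum (tensor_bilin.1 _)).
Qed.

(** * The operators alpha_i *)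

Section Alpha.
Context {k : fieldType} {A : vectType k}.

Lemma alpha_linear i : linear (@alpha A i : (A * A)%type -> (A * A)%type).
Proof.
move=> c [x y] [z w]; rewrite /alpha.
(* Index 0 falls into the default branch, that of alpha_4, like every index above 3. *)
case: i => [|[|[|[|i]]]]; congr pair;
  by rewrite /= ?opprD ?scalerDr ?scalerN ?scaler0 ?addr0 // addrACA.
Qed.

Variables succ prec dot : A -> A -> A.
Hypotheses (succP : bilinear_op succ) (precP : bilinear_op prec).
Hypothesis dotP : bilinear_op dot.

(** Each - alpha_i is the projection onto one of A x 0, 0 x A and the diagonal along another. All
    three are closed under the product, the diagonal because the product on the first factor is the
    sum of the three operations; minus such a projection is Rota-Baxter of weight 1. The proof
    expands both components. *)
Lemma alpha_rota_baxter i :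
  rota_baxter (sdprod (fun x y => succ x y + prec x y + dot x y) dot
    (Lop succ) (Rop prec)) (alpha i).
Proof.
have [[sl sr] [pl pr] [dl dr]] := And3 succP precP dotP.
have sE := (fun z => linD (sl z), fun z => linD (sr z), fun z => linN (sl z),
  fun z => linN (sr z), fun z => lin0 (sl z), fun z => lin0 (sr z)).
have pE := (fun z => linD (pl z), fun z => linD (pr z), fun z => linN (pl z),
  fun z => linN (pr z), fun z => lin0 (pl z), fun z => lin0 (pr z)).
have dE := (fun z => linD (dl z), fun z => linD (dr z), fun z => linN (dl z),
  fun z => linN (dr z), fun z => lin0 (dl z), fun z => lin0 (dr z)).
move=> [x y] [z w]; case: i => [|[|[|[|i]]]]; rewrite /alpha /sdprod /Lop /Rop;
  congr pair => /=; rewrite !(sE, pE, dE); vect_ring.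
Qed.
End Alpha.

(** * Tridendriform deformations *)

(** The seven axioms are, one by one, the associativity of [doth] and the six bimodule algebra
    conditions; they add up to the associativity of [circh]. *)
Lemma tridendriform_semidirect (k : fieldType) (A : vectType k)
    (succh prech doth circh : fps A -> fps A -> fps A) :
  is_tridendriform succh prech doth ->
  (forall x y, circh x y = succh x y + prech x y + doth x y) ->
  is_assoc_alg (fsdprod circh doth (Lop succh) (Rop prech)
    : fps (A * A)%type -> _ -> fps (A * A)%type).
Proof.
case=> [[sP pP dP] ax] circE.
(* [tri_circ] adds its summands in another order than [circh]. *)
have {}ax x y z : [/\ prech (prech x y) z = prech x (circh y z),
    prech (succh x y) z = succh x (prech y z) &
    succh (circh x y) z = succh x (succh y z)] /\
  [/\ doth (succh x y) z = succh x (doth y z),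
    doth (prech x y) z = doth x (succh y z),
    prech (doth x y) z = doth x (prech y z) &
    doth (doth x y) z = doth x (doth y z)].
  rewrite !circE [succh x y + _]addrC [succh y z + _]addrC; exact: ax.
have circA : associative circh.
  move=> x y z; have [[pp sp cs] [ds dp pd dd]] := ax x y z.
  rewrite [LHS]circE [RHS]circE -pp cs !circE.
  rewrite !(linD (sP.2 _)) !(linD (dP.2 _)) !(linD (pP.1 _)) !(linD (dP.1 _)).
  rewrite sp ds dp pd dd.
  apply: fpsP => n; rewrite !fpsDE; vect_ring.
have circP : bilinear_op circh.
  by split=> ? ? ? ?; rewrite !circE ?(sP.1, pP.1, dP.1) ?(sP.2, pP.2, dP.2)
    !scalerDr [RHS]addrACA [X in _ = X + _]addrACA.
apply: fsdprod_assoc_alg; apply: sdprod_assoc_alg => //.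
- by split=> ?; [apply: pP.2 | apply: pP.1].
- by move=> x y z; have [_ []] := ax x y z.
- by move=> x y z; have [[]] := ax x y z.
- by move=> x y z; have [[]] := ax z x y.
- by move=> x y z; have [[]] := ax x z y.
- by move=> x y z; have [_ []] := ax x y z.
- by move=> x y z; have [_ []] := ax y z x.
- by move=> x y z; have [_ []] := ax y x z.
Qed.

(** For a functional v, v (m w x) - v (m x w) is minus v of the commutator of x and w: the left
    action minus the right one is the coadjoint representation. *)
Lemma commutator_sdprod_dual (k : fieldType) (B : vectType k)
    (m : B -> B -> B) : bilinear_op m ->
  commutator_op (sdprod_dual m) = sdbracket (commutator_op m) zero_op
    (dual_rep (Lop (commutator_op m))).
Proof.
move=> mP; apply: funext => -[x u]; apply: funext => -[y v].
congr pair; rewrite /= addr0 !addr0; apply/lfunP => w.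
have cP z : linear (Lop (commutator_op m) z).
  exact: linear_add (mP.2 z) (linear_opp (mP.1 z)).
move: (neg_rep _ x v) (neg_rep _ y u) (neg_rep _ y u) (neg_rep _ x v)
  (lactE mP x v) (ractE mP y u) (lactE mP y u) (ractE mP x v).
move=> xv yu uy vx xvE yuE uyE vxE.
rewrite !(add_lfunE, opp_lfunE) !dual_repE //.
rewrite xvE yuE uyE vxE /Lop /commutator_op (linearB v) (linearB u) /=; ring.
Qed.

Lemma commutator_sdprod (k : comNzRingType) (B V : lmodType k)
    (mulB : B -> B -> B) (mulV : V -> V -> V) (l r : B -> V -> V) :
  commutator_op (sdprod mulB mulV l r : (B * V)%type -> _ -> (B * V)%type) =
  sdbracket (commutator_op mulB) (commutator_op mulV)
    (fun x v => l x v - r x v).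
Proof.
apply: funext => -[x u]; apply: funext => -[y v]; congr pair => /=.
rewrite !opprD addrACA; congr (_ + _).
by rewrite opprK [X in _ + X = _]addrC addrACA [X in _ = _ + X]addrC.
Qed.

(** * The quasiclassical limit of the double and its constant solutions *)

Section DualDoubleQCL.
Context {k : fieldType} {B : vectType k} (mh : fps B -> fps B -> fps B).
Hypotheses (mhA : is_assoc_alg mh) (m0C : commutative (coef_op mh 0)).

Local Notation Dh := (fsdprod_dual mh).
Local Notation D := (sdprod_dual (coef_op mh 0)).
Local Notation br := (commutator_op (sdprod_dual (coef_op mh 1))).

Let DhA : is_assoc_alg Dh.
Proof. exact: fsdprod_dual_assoc_alg. Qed.

Let m_bilin n : bilinear_op (coef_op mh n).
Proof. exact: coef_op_bilin mhA.1 n. Qed.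

Lemma sdprod_dual_comm_assoc_alg : is_comm_assoc_alg D.
Proof.
split; first by rewrite -coef_fsdprod_dual; apply: coef_op0_assoc_alg.
move=> x y; rewrite [RHS]sdprod_dual_opp; congr sdprod_dual.
by apply: funext => u; apply: funext => v; apply: m0C.
Qed.

Lemma qcl_sdprod_dual : qcl_bracket Dh = br.
Proof. by rewrite -coef_fsdprod_dual. Qed.

Lemma sdprod_dual_QCL : is_QCL Dh br D.
Proof.
have [DA DC] := sdprod_dual_comm_assoc_alg.
split; last by rewrite qcl_sdprod_dual.
- by split=> // x y; rewrite -coef_fsdprod_dual.
- have DhC : commutative (coef_op Dh 0) by rewrite coef_fsdprod_dual.
  rewrite -qcl_sdprod_dual -(coef_fsdprod_dual mh 0).
  exact: (qcl_Poisson_alg DhA DhC).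
Qed.

(** The AYBE for the constant series needs all coefficients; the CYBE compares coefficient 1 with
    its opposite; a symmetric part proportional to [casimir] is invariant in each degree. *)
Lemma scalar_solution (c : k) (r : tens (dbl B) (dbl B)) :
  (forall n, AYB (sdprod_dual (coef_op mh n)) r = 0) ->
  AYB (sdprod_dual (fun x y => coef_op mh 1 y x)) r = 0 ->
  r + flip r = c *: casimir ->
  [/\ solves_AYBE D r, solves_fAYBE Dh (fconst r), solves_PYBE br D r &
      is_QCL_solution Dh br D (fconst r) r].
Proof.
move=> rA rAop rsym.
have rfA : solves_fAYBE Dh (fconst r).
  by apply: fpsP => n; rewrite fAYB_fconst coef_fsdprod_dual rA.
have rP : solves_PYBE br D r.
  split; first exact: rA.
  rewrite CYB_commutator rA.
  (* The opposite of the double is the double of the opposite, to which [rAop] applies. *)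
  have -> : (fun x y => sdprod_dual (coef_op mh 1) y x) =
      sdprod_dual (fun x y => coef_op mh 1 y x).
    by apply: funext => x; apply: funext => y; apply: sdprod_dual_opp.
  by rewrite rAop subrr.
split; [exact: rA | exact: rfA | exact: rP |].
split; [exact: sdprod_dual_QCL | exact: rfA | | by [] | exact: rP].
rewrite /fsym_part fflip_fconst -fconstD rsym -fconstZ.
apply: finvariant_fconst => [|n x]; first exact: DhA.1.
rewrite scalerA; set T := tens_lift _.
have -> : T (2%:R^-1 * c *: casimir) = 2%:R^-1 * c *: T casimir.
  apply: linZ; apply: tens_lift_linear => v.
  have DP := coef_op_bilin DhA.1 n.
  exact: linear_add (linear_comp (tensor_bilin.2 v) (DP.2 x))
    (linear_opp (tensor_bilin.2 _)).
by rewrite /T coef_fsdprod_dual casimir_invariant ?scaler0.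
Qed.
End DualDoubleQCL.

(** * The elements r and r_h *)

Section RMatrixForms.
Context {k : fieldType} {B : vectType k} (f : B -> B) (fh : fps B -> fps B).

Lemma rmatrix_idE : rmatrix_id f = skew_rmatrix (fun x => f x + x) f.
Proof.
by rewrite /rmatrix_id !eta_tilde /skew_rmatrix (canonical_tensorD f id) addrAC.
Qed.

Lemma rmatrix_flip_idE : rmatrix_flip_id f = skew_rmatrix f (fun x => f x + x).
Proof.
rewrite /rmatrix_flip_id !eta_tilde /skew_rmatrix (canonical_tensorD f id).
by rewrite (linD (@flip_linear _ _ _)) opprD addrA.
Qed.

Hypothesis fhE : forall v, fh (fconst v) = fconst (f v).

(** The basis, the coordinate functionals and, by [fhE], the images of the basis under [fh] are
    constant series, hence so is r_h. *)
Lemma frmatrix_id_fconst : frmatrix_id fh = fconst (rmatrix_id f).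
Proof.
have fconstE (r s t : tens (dbl B) (dbl B)) :
  fconst (r - s + t) = fconst r - fconst s + fconst t.
  by rewrite !fconstD fconstN.
rewrite /rmatrix_id fconstE.
congr (_ - _ + _).
- by rewrite (ftilde_fconst fhE) feta_fconst.
- by rewrite (ftilde_fconst fhE) feta_fconst fflip_fconst.
- by rewrite (ftilde_fconst (g := id)) // feta_fconst.
Qed.

Lemma frmatrix_flip_id_fconst :
  frmatrix_flip_id fh = fconst (rmatrix_flip_id f).
Proof.
have fconstE (r s t : tens (dbl B) (dbl B)) :
  fconst (r - s - t) = fconst r - fconst s - fconst t.
  by rewrite !fconstD !fconstN.
rewrite /rmatrix_flip_id fconstE.
congr (_ - _ - _).
- by rewrite (ftilde_fconst fhE) feta_fconst.
- by rewrite (ftilde_fconst fhE) feta_fconst fflip_fconst.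
- by rewrite (ftilde_fconst (g := id)) // feta_fconst fflip_fconst.
Qed.
End RMatrixForms.

Lemma falpha_fconst (k : comNzRingType) (V : lmodType k) i (v : V * V) :
  falpha i (fconst v) = fconst (alpha i v).
Proof.
case: v => x y; rewrite /falpha fsplit_fconst.
rewrite [alpha i (x, y)]surjective_pairing.
rewrite -fjoin_fconst /alpha; congr fjoin.
by case: i => [|[|[|[|i]]]]; rewrite /= ?fconst0 ?fconstD ?fconstN.
Qed.

Theorem theorem4p25 (k : fieldType) (k_char0 : [pchar k] =i pred0)
  (A : vectType k) (succ dot : A -> A -> A)
  (A_comm_tridend : is_comm_tridendriform succ dot)
  (succh prech doth : fps A -> fps A -> fps A)
  (Ah_deform : is_tridend_deformation succ (fun x y => succ y x) dot
                 succh prech doth)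
  (brack tri : A -> A -> A)
  (brackE : forall x y, brack x y = qcl_bracket doth x y)
  (triE : forall x y, tri x y = qcl_triangle succh prech x y)
  (i : nat) (i_range : (1 <= i <= 4)%N) :
  let circ : A -> A -> A := fun x y => succ x y + succ y x + dot x y in
  let poiss : A -> A -> A := fun x y => tri x y - tri y x + brack x y in
  let circh : fps A -> fps A -> fps A :=
    fun x y => succh x y + prech x y + doth x y in
  let B : vectType k := (A * A)%type in
  (* \hat A, \hat A_h and \check A *)
  let odot : B -> B -> B := comm_sdprod circ dot (Lop succ) in
  let odoth : fps B -> fps B -> fps B :=
    fsdprod circh doth (Lop succh) (Rop prech) in
  let brackB : B -> B -> B := sdbracket poiss brack (Lop tri) in
  (* their semidirect products with the duals of the underlying spaces *)
  let D : dbl B -> dbl B -> dbl B :=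
    comm_sdprod odot zero_op (neg_rep (dual_rep (Rop odot))) in
  let Dh : fps (dbl B) -> fps (dbl B) -> fps (dbl B) :=
    fsdprod odoth zero_op (neg_rep (fdual_rep (Rop odoth)))
                          (neg_rep (fdual_rep (Lop odoth))) in
  let brackD : dbl B -> dbl B -> dbl B :=
    sdbracket brackB zero_op (dual_rep (Lop brackB)) in
  (* (1) *)
  [/\ is_comm_assoc_alg D, is_assoc_deformation D Dh & is_QCL Dh brackD D] /\
  (* (2) *)
  (let r := rmatrix_id (alpha i : B -> B) in
   let rh := frmatrix_id (falpha i : fps B -> fps B) in
   [/\ solves_AYBE D r, solves_fAYBE Dh rh, rh = fconst r,
       solves_PYBE brackD D r & is_QCL_solution Dh brackD D rh r]) /\
  (let r := rmatrix_flip_id (alpha i : B -> B) in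
   let rh := frmatrix_flip_id (falpha i : fps B -> fps B) in
   [/\ solves_AYBE D r, solves_fAYBE Dh rh, rh = fconst r,
       solves_PYBE brackD D r & is_QCL_solution Dh brackD D rh r]).
Proof.
move=> circ poiss circh B odot odoth brackB D Dh brackD.
have [[tri_ax [succ0 prec0 dot0]] [_ dotC]] := (Ah_deform, A_comm_tridend).
have circhE x y : circh x y = succh x y + prech x y + doth x y by [].
have odothA : is_assoc_alg odoth := tridendriform_semidirect tri_ax circhE.
have odothE n : coef_op odoth n = sdprod (fun x y => coef_op succh n x y
    + coef_op prech n x y + coef_op doth n x y) (coef_op doth n)
    (Lop (coef_op succh n)) (Rop (coef_op prech n)).
  exact: coef_fsdprod.
(* Modulo h the right action by [prech] becomes the left action by [succ], as [prech] reduces to the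
   flip of [succ]. *)
have odot0 : coef_op odoth 0 = odot.
  rewrite odothE; apply: funext => p; apply: funext => q.
  by congr pair; congr (_ + _ + _);
    first [exact: succ0 | exact: prec0 | exact: dot0].
have odotC : commutative odot.
  move=> [x u] [y v]; congr pair => /=.
    by rewrite /circ dotC [succ x y + _]addrC.
  by rewrite dotC [Lop succ x v + _]addrC.
(* Commutativity of [odot] identifies its two dual actions, which is why [D] has a single one. *)
have DE : D = sdprod_dual (coef_op odoth 0).
  rewrite odot0 /D /sdprod_dual /comm_sdprod.
  congr (sdprod _ _ _ (neg_rep (dual_rep _))).
  by apply: funext => x; apply: funext => y; apply: odotC.
have DhE : Dh = fsdprod_dual odoth by [].
(* In degree 1, [succh] at (x, y) minus [prech] at (y, x) is [tri]; so the commutator has the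
   bracket [poiss] on the first factor and the representation [tri] on the second. *)
have brackBE : brackB = commutator_op (coef_op odoth 1).
  rewrite odothE [RHS]commutator_sdprod; apply: funext => p; apply: funext => q.
  congr pair => /=; last first.
    by rewrite brackE /Lop !triE.
  have tri1 x y : tri x y = coef_op succh 1 x y - coef_op prech 1 y x :=
    triE x y.
  have brack1 x y : brack x y = coef_op doth 1 x y - coef_op doth 1 y x :=
    brackE x y.
  rewrite /poiss /commutator_op !tri1 brack1; vect_ring.
have brackDE : brackD = commutator_op (sdprod_dual (coef_op odoth 1)).
  rewrite commutator_sdprod_dual -?brackBE //.
  exact: coef_op_bilin odothA.1 1%N.
have m0C : commutative (coef_op odoth 0) by rewrite odot0.
have [[sP pP dP] _] := tri_ax.
have mP n : bilinear_op (coef_op odoth n) := coef_op_bilin odothA.1 n.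
have aP := @alpha_linear k A i.
have aRB n : rota_baxter (coef_op odoth n) (alpha i).
  by rewrite odothE; apply: alpha_rota_baxter; apply: coef_op_bilin.
have m1P : bilinear_op (fun x y => coef_op odoth 1 y x).
  by split=> ?; [apply: (mP _).2 | apply: (mP _).1].
have QCL := sdprod_dual_QCL odothA m0C.
have ahE (v : B) : falpha i (fconst v) = fconst (alpha i v : B).
  exact: falpha_fconst.
rewrite DE DhE brackDE; split; [|split].
- split; [exact: sdprod_dual_comm_assoc_alg | by case: QCL | exact: QCL].
- move=> r rh.
  have rhE : rh = fconst r by apply: frmatrix_id_fconst.
  (* The scalar 1 is f - g for f = alpha_i + id and g = alpha_i. *)
  have [] := @scalar_solution k B odoth odothA m0C 1 r.
  + by move=> n; rewrite /r rmatrix_idE; apply: AYB_rota_baxterl.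
  + rewrite /r rmatrix_idE; apply: AYB_rota_baxterl => //.
    exact: rota_baxter_opp.
  + rewrite /r rmatrix_idE; apply: skew_rmatrix_sym_part => x.
    by rewrite addrAC subrr add0r scale1r.
  + by rewrite rhE.
- move=> r rh.
  have rhE : rh = fconst r by apply: frmatrix_flip_id_fconst.
  (* Here id is added to g instead, so the scalar is -1. *)
  have [] := @scalar_solution k B odoth odothA m0C (-1) r.
  + by move=> n; rewrite /r rmatrix_flip_idE; apply: AYB_rota_baxterr.
  + rewrite /r rmatrix_flip_idE; apply: AYB_rota_baxterr => //.
    exact: rota_baxter_opp.
  + rewrite /r rmatrix_flip_idE; apply: skew_rmatrix_sym_part => x.
    by rewrite opprD addrA subrr sub0r scaleN1r.
  + by rewrite rhE.
Qed.
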